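(* Let $A_0B_0C_0$ be a (non-degenerate) triangle in the Euclidean plane. For $i \ge 0$ denote the centroid of $A_iB_iC_i$ by $G_i$ and the $G_i$-focal triangle of $A_iB_iC_i$ by $A_{i+1}B_{i+1}C_{i+1}$. Then the sequences of triangles $$\bigl(A_{2i}B_{2i}C_{2i}\bigr)_{i\ge 0}\quad\text{and}\quad \bigl(A_{2i+1}B_{2i+1}C_{2i+1}\bigr)_{i\ge 0}$$ both converge (vertex by vertex), their limits are both equilateral triangles, and the vertices of these two limit triangles together form the vertices of a regular hexagon.
   Context: An exparabola of a triangle $ABC$ is a (real, non-degenerate) parabola that is tangent to the three side lines $BC$, $CA$, $AB$ of the triangle. It is called opposite to $C$ if it is tangent to $AB$ in a point strictly between $A$ and $B$; opposite to $A$ and opposite to $B$ are defined analogously with the sides $BC$ and $CA$. The axis of a parabola is its line of symmetry. For the centroid $G$ of a triangle $ABC$ there are exactly three exparabolas of $ABC$ whose axes are incident with $G$, one opposite to each vertex; the $G$-focal triangle of $ABC$ is the triangle $F_AF_BF_C$ formed by their foci, where $F_A$, $F_B$, $F_C$ is the focus of the exparabola opposite to $A$, $B$, $C$, respectively. In the iteration, $A_{i+1}$, $B_{i+1}$, $C_{i+1}$ are the foci of the exparabolas of $A_iB_iC_i$ with axes through $G_i$ that are opposite to $A_i$, $B_i$, $C_i$, respectively. *)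

(* Defs.v *)
From HB Require Import structures.
From mathcomp Require Import all_boot all_order all_algebra.
From mathcomp Require Import all_classical all_reals all_analysis.

Set Implicit Arguments.
Unset Strict Implicit.
Unset Printing Implicit Defensive.

Import Order.TTheory GRing.Theory Num.Theory.
Import numFieldNormedType.Exports.

Local Open Scope classical_set_scope.
Local Open Scope ring_scope.

(** The Euclidean plane over [R] is [R * R].  The library norm on this product
    is the maximum norm, so the Euclidean distance is defined here; the product
    topology used for convergence is the Euclidean one. *)
Notation plane R := (R * R)%type.

Section Plane.
Variable R : realType.
Implicit Types A B C D E F G O P Q S T X Y : plane R.

Definition dot (u v : plane R) : R := u.1 * v.1 + u.2 * v.2.

Definition vec P Q : plane R := (Q.1 - P.1, Q.2 - P.2).

Definition dist P Q : R := Num.sqrt (dot (vec P Q) (vec P Q)).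

(** Twice the signed area of [ABC]; positive iff [A], [B], [C] are in
    counterclockwise order. *)
Definition orient A B C : R :=
  (vec A B).1 * (vec A C).2 - (vec A B).2 * (vec A C).1.

Definition nondegenerate_triangle A B C : Prop := orient A B C != 0.

(** [along P Q t] is P + t (Q - P). *)
Definition along P Q (t : R) : plane R :=
  (P.1 + t * (Q.1 - P.1), P.2 + t * (Q.2 - P.2)).

(** A line only when [P <> Q]. *)
Definition line P Q : set (plane R) := [set along P Q t | t in [set: R]].

Definition strictly_between P Q T : Prop :=
  exists t : R, [/\ 0 < t, t < 1 & T = along P Q t].

Definition dist_to_set X (L : set (plane R)) : R :=
  inf [set dist X Y | Y in L].

(** Orthogonal projection of [X] on the line [PQ], for [P <> Q]. *)
Definition foot P Q X : plane R :=
  along P Q (dot (vec P Q) (vec P X) / dot (vec P Q) (vec P Q)).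

Definition reflection P Q X : plane R := along X (foot P Q X) 2.

(** The directrix is the line through [directrix1] and [directrix2]. *)
Record parabola := Parabola {
  focus : plane R;
  directrix1 : plane R;
  directrix2 : plane R;
  directrix_neq : directrix1 <> directrix2;
  focus_off_directrix : ~ line directrix1 directrix2 focus
}.

Definition directrix (p : parabola) : set (plane R) :=
  line (directrix1 p) (directrix2 p).

Definition locus (p : parabola) : set (plane R) :=
  [set X | dist X (focus p) = dist_to_set X (directrix p)].

(** The line [PQ] is the axis (line of symmetry) of [p]. *)
Definition is_axis (p : parabola) P Q : Prop :=
  P <> Q /\ reflection P Q @` locus p = locus p.

Definition axis_through (p : parabola) X : Prop :=
  exists P Q, is_axis p P Q /\ line P Q X.

(** Lines perpendicular to the directrix, i.e. parallel to the axis, also meet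
    the parabola in a single point, but are not tangents. *)
Definition tangent_at (p : parabola) P Q T : Prop :=
  [/\ P <> Q,
      line P Q `&` locus p = [set T] &
      dot (vec P Q) (vec (directrix1 p) (directrix2 p)) != 0].

Definition tangent (p : parabola) P Q : Prop := exists T, tangent_at p P Q T.

Definition exparabola A B C (p : parabola) : Prop :=
  [/\ tangent p B C, tangent p C A & tangent p A B].

(** For an exparabola of [ABC]: being opposite to [A] is [touches_inside p B C],
    and similarly for the other vertices. *)
Definition touches_inside (p : parabola) P Q : Prop :=
  exists T, strictly_between P Q T /\ tangent_at p P Q T.

(** The focus of the exparabola of [ABC] opposite to the first listed vertex [A]
    whose axis passes through [G].  [get] returns the element of this set if
    there is one, and is arbitrary otherwise; for a nondegenerate triangle and
    its centroid the set is a singleton. *)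
Definition opposite_focus G A B C : plane R :=
  get [set F | exists p : parabola,
    [/\ focus p = F, exparabola A B C p, touches_inside p B C
      & axis_through p G]].

Definition focal_triangle G A B C : plane R * plane R * plane R :=
  (opposite_focus G A B C, opposite_focus G B C A, opposite_focus G C A B).

Definition centroid A B C : plane R :=
  ((A.1 + B.1 + C.1) / 3, (A.2 + B.2 + C.2) / 3).

Definition equilateral A B C : Prop :=
  [/\ nondegenerate_triangle A B C, dist A B = dist B C & dist B C = dist C A].

(** The angle at [Q], in [0, pi]. *)
Definition angle P Q S : R :=
  acos (dot (vec Q P) (vec Q S) / (dist Q P * dist Q S)).

(** Convex with all sides equal and all angles equal.  The vertices are listed
    counterclockwise; [ordS] and [ord_pred] are cyclic.  The first clause says
    that every side has all the other vertices strictly on its left. *)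
Definition regular_hexagon (H : 'I_6 -> plane R) : Prop :=
  [/\ forall i j, j != i -> j != ordS i -> 0 < orient (H i) (H (ordS i)) (H j),
      forall i j, dist (H i) (H (ordS i)) = dist (H j) (H (ordS j)) &
      forall i j, angle (H (ord_pred i)) (H i) (H (ordS i)) =
                  angle (H (ord_pred j)) (H j) (H (ordS j))].

Definition regular_hexagon_vertices (V : set (plane R)) : Prop :=
  exists H : 'I_6 -> plane R, regular_hexagon H /\ range H = V.

End Plane.

(* Main.v *)
(** Place the origin at the circumcenter [O] and let [a], [b], [c] be the vertices
    as complex numbers of modulus [r].  In coordinates adapted to a parabola, three
    tangents of slopes [sa], [sb], [sc] form a triangle whose centroid is on the axis
    iff [sa + sb + sc = 0], and the tangent point on [BC] is inside the side iff [sa]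
    is between [sb] and [sc].  Translated to complex numbers, the focus [f] is on the
    circumcircle, on the arc [BC] not containing [A], and it is a root of
    [f^3 + abc = (s f^2 + abc conj(s) f / r^2) / 3], where [s = a + b + c].  The foci
    opposite to [A], [B], [C] are therefore the three roots of one cubic, so
    that the sum of the vertices is divided by 3 in each step, and
    [(f + a)(f + b)(f + c) = O(s)].  Once the triangle is nearly equilateral, only the
    factor [f + a] can be small for the focus [f] opposite to [A].  So [a_{i+1} + a_i]
    tends to 0 geometrically, hence [(-1)^i a_i] converges, and likewise for [b] and
    [c]; the limits have equal moduli and sum 0. *)

Require Import Defs.
From HB Require Import structures.
From mathcomp Require Import all_boot all_order all_algebra.
From mathcomp Require Import all_classical all_reals all_analysis.
From mathcomp Require Import complex ring lra.

Set Implicit Arguments.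
Unset Strict Implicit.
Unset Printing Implicit Defensive.

Import Order.TTheory GRing.Theory Num.Theory.
Import numFieldNormedType.Exports.

Local Open Scope classical_set_scope.
Local Open Scope ring_scope.

(** * Parabolas in a frame centered at the focus *)

Definition cross {R : realType} (u v : plane R) : R := u.1 * v.2 - u.2 * v.1.

(** Both sides are polynomials in [s]. The coefficient of degree 4 is [a ^+ 2] on the left and 0 on
    the right; once [a = 0], degrees 2 and 1 give the rest. *)
Lemma parabola_reparam {R : realType} (a b c a' b' c' k : R) :
  (forall s, (a * s ^+ 2 + b * s + c) ^+ 2 = k * (2 * (a' * s ^+ 2 + b' * s + c') + k)) ->
  [/\ a = 0, b ^+ 2 = 2 * k * a' & b * c = k * b'].
Proof.
(* Five values determine a polynomial of degree at most 4. *)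
move=> h; have [h0 h1 h2 h3 h4] :
  [/\ c ^+ 2 = k * (2 * c' + k), (a + b + c) ^+ 2 = k * (2 * (a' + b' + c') + k),
   (a - b + c) ^+ 2 = k * (2 * (a' - b' + c') + k),
   (4 * a + 2 * b + c) ^+ 2 = k * (2 * (4 * a' + 2 * b' + c') + k) &
   (4 * a - 2 * b + c) ^+ 2 = k * (2 * (4 * a' - 2 * b' + c') + k)].
  by split; [have := h 0|have := h 1|have := h (-1)|have := h 2|have := h (-2)];
    move=> e; [rewrite -[LHS]addr0|..]; lra.
have a0 : a = 0 by apply/eqP; rewrite -sqrf_eq0; apply/eqP; lra.
by split=> //; rewrite a0 in h0 h1 h2 h3 h4; lra.
Qed.

Section Frame.
Variables (R : realType) (p : parabola R).
Implicit Types P Q T X G : plane R.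

(* The frame at the focus with first axis along the directrix.  Lengths in it are
   scaled by the length of [dirvec], and [param] is the scaled signed distance of
   the focus from the directrix. *)
Definition dirvec : plane R := vec (directrix1 p) (directrix2 p).
Definition frx X : R := dot dirvec (vec (focus p) X).
Definition fry X : R := cross dirvec (vec (focus p) X).
Definition param : R := cross dirvec (vec (directrix1 p) (focus p)).

Lemma dot_ge0 (u : plane R) : 0 <= dot u u.
Proof. by rewrite /dot addr_ge0 // -expr2 sqr_ge0. Qed.

Lemma dot_eq0 (u : plane R) : dot u u = 0 -> u = (0, 0).
Proof.
case: u => x y; rewrite /dot /= -!expr2 => /eqP.
by rewrite paddr_eq0 ?sqr_ge0 // !sqrf_eq0 => /andP[/eqP -> /eqP ->].
Qed.

Lemma dot_vec_gt0 P Q : P <> Q -> 0 < dot (vec P Q) (vec P Q).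
Proof.
move=> PQ; rewrite lt_neqAle dot_ge0 andbT eq_sym.
apply/eqP => /dot_eq0 [h1 h2]; apply: PQ.
by case: P Q h1 h2 => [p1 p2] [q1 q2] /= /subr0_eq -> /subr0_eq ->.
Qed.

Lemma dirvec_gt0 : 0 < dot dirvec dirvec.
Proof. exact/dot_vec_gt0/directrix_neq. Qed.

Lemma dirvec_neq0 : dot dirvec dirvec != 0.
Proof. by rewrite gt_eqF ?dirvec_gt0. Qed.

Lemma param_neq0 : param != 0.
Proof.
apply/eqP => k0; apply: (@focus_off_directrix R p).
have N0 := dirvec_neq0.
exists (dot dirvec (vec (directrix1 p) (focus p)) / dot dirvec dirvec) => //.
move: k0 N0; rewrite /param /cross /along /dot /dirvec /vec.
case: (focus p) (directrix1 p) (directrix2 p) => [f1 f2] [d1 d2] [e1 e2] /=.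
move=> k0 N0; congr pair; apply/eqP; rewrite -subr_eq0; apply/eqP.
- transitivity (- (e2 - d2) * ((e1 - d1) * (f2 - d2) - (e2 - d2) * (f1 - d1)) * -1
     / ((e1 - d1) * (e1 - d1) + (e2 - d2) * (e2 - d2))); last by rewrite k0 mulr0 !mul0r.
  by field.
- transitivity (- (e1 - d1) * ((e1 - d1) * (f2 - d2) - (e2 - d2) * (f1 - d1))
     / ((e1 - d1) * (e1 - d1) + (e2 - d2) * (e2 - d2))); last by rewrite k0 mulr0 !mul0r.
  by field.
Qed.

(** Up to sign, [fry X + param] is the cross product of [dirvec] with the vector from [X] to any
    point of the directrix. Lagrange's identity makes it a lower bound for the scaled distances,
    attained at the foot of the perpendicular. *)
Lemma dist_to_directrix X :
  dist_to_set X (directrix p) =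
  `|fry X + param| / Num.sqrt (dot dirvec dirvec).
Proof.
have N0 := dirvec_gt0; have N0' := dirvec_neq0.
have sN : 0 < Num.sqrt (dot dirvec dirvec) by rewrite sqrtr_gt0.
have key Y : directrix p Y -> `|fry X + param| / Num.sqrt (dot dirvec dirvec) <= dist X Y.
  case=> t _ <-; rewrite ler_pdivrMr // /dist -sqrtrM ?dot_ge0 //.
  rewrite -sqrtr_sqr ler_wsqrtr // -subr_ge0.
  set v := vec X _.
  suff -> : dot v v * dot dirvec dirvec - (fry X + param) ^+ 2 =
     dot v dirvec ^+ 2 by rewrite sqr_ge0.
  rewrite /v /fry /param /cross /along /dot /dirvec /vec.
  case: (focus p) (directrix1 p) (directrix2 p) X {v} => [f1 f2] [d1 d2] [e1 e2] [x1 x2] /=.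
  by ring.
have att : [set dist X Y | Y in directrix p]
    (`|fry X + param| / Num.sqrt (dot dirvec dirvec)).
  exists (foot (directrix1 p) (directrix2 p) X); first by eexists.
  rewrite /dist -(sqrtr_sqr (fry X + param)) -sqrtrV ?dot_ge0 // -sqrtrM ?sqr_ge0 //.
  congr Num.sqrt.
  move: N0'; rewrite /foot /fry /param /cross /along /dot /dirvec /vec.
  case: (focus p) (directrix1 p) (directrix2 p) X {key} => [f1 f2] [d1 d2] [e1 e2] [x1 x2] /=.
  by move=> N0'; field.
apply/le_anti/andP; split.
- apply: ge_inf att; exists (`|fry X + param| / Num.sqrt (dot dirvec dirvec)).
  by move=> _ [Y /key ? <-].
- apply: lb_le_inf; first by exists (`|fry X + param| / Num.sqrt (dot dirvec dirvec)).
  by move=> _ [Y /key ? <-].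
Qed.

Lemma fr_norm X :
  dot (vec X (focus p)) (vec X (focus p)) * dot dirvec dirvec = frx X ^+ 2 + fry X ^+ 2.
Proof. rewrite /frx /fry /dot /cross /dirvec /vec /=; ring. Qed.

Lemma locusP X : locus p X <-> frx X ^+ 2 = param * (2 * fry X + param).
Proof.
have N0 := dirvec_gt0; have N0' := dirvec_neq0.
have sN : Num.sqrt (dot dirvec dirvec) != 0 by rewrite gt_eqF // sqrtr_gt0.
have -> : locus p X <-> dist X (focus p) * Num.sqrt (dot dirvec dirvec) = `|fry X + param|.
  rewrite /locus /= dist_to_directrix; split=> [->|<-]; first by rewrite mulfVK.
  by rewrite mulfK.
rewrite /dist -sqrtrM ?dot_ge0 // fr_norm -sqrtr_sqr; split.
- move=> /(congr1 (fun x => x ^+ 2)).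
  rewrite !sqr_sqrtr ?addr_ge0 ?sqr_ge0 // => h.
  by apply: (addIr (fry X ^+ 2)); rewrite h; ring.
- by move=> ->; congr Num.sqrt; ring.
Qed.

Lemma frx_along P Q t : frx (along P Q t) = frx P + t * (frx Q - frx P).
Proof. by rewrite /frx /along /dot /vec /=; ring. Qed.

Lemma fry_along P Q t : fry (along P Q t) = fry P + t * (fry Q - fry P).
Proof. by rewrite /fry /along /cross /vec /=; ring. Qed.

Lemma frx_vec P Q : dot (vec P Q) dirvec = frx Q - frx P.
Proof. by rewrite /frx /dot /vec /=; ring. Qed.

(* A line of slope [s] in the frame of [p] is a tangent iff it satisfies this
   equation, and then the abscissa of the point of contact is [param * s]. *)
Definition touch_slope (s : R) X : Prop :=
  2 * (fry X - frx X * s) + param * (1 + s ^+ 2) = 0.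

(** On a line not parallel to the axis, the locus equation is quadratic in the line parameter; a
    single common point forces a double root. *)
Lemma tangent_slope P Q T : tangent_at p P Q T ->
  exists2 s, [/\ fry Q - fry P = s * (frx Q - frx P), touch_slope s P & touch_slope s Q]
    & frx Q - frx P != 0 /\ frx T = param * s.
Proof.
have k0 := param_neq0.
case=> PQ PQT; rewrite frx_vec => dx0.
set dx := frx Q - frx P in dx0 *; set dy := fry Q - fry P.
have [t0 tT] : exists t, along P Q t = T.
  have : [set T] T by []. rewrite -PQT => -[[t _ ?] _]; by exists t.
have eqn t : locus p (along P Q t) <->
    (frx P + t * dx) ^+ 2 = param * (2 * (fry P + t * dy) + param).
  by rewrite locusP frx_along fry_along.
have LT : locus p (along P Q t0).
  have : [set T] T by []. by rewrite -PQT tT => -[].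
have /eqn L0 := LT.
(* The second root by Vieta; it also yields a point of the locus, hence equals [t0]. *)
pose t1 := 2 * (param * dy - frx P * dx) / dx ^+ 2 - t0.
have L1 : locus p (along P Q t1).
  apply/eqn; apply/eqP; rewrite -subr_eq0; apply/eqP.
  transitivity ((frx P + t0 * dx) ^+ 2 - param * (2 * (fry P + t0 * dy) + param)).
    by rewrite /t1; field.
  by rewrite L0 subrr.
have /(congr1 frx) : along P Q t1 = T.
  have : [set T] (along P Q t1) by rewrite -PQT; split => //; exists t1.
  by [].
rewrite -tT !frx_along -/dx => /addrI /(mulIf dx0) t10.
have t0E : t0 = (param * dy - frx P * dx) / dx ^+ 2.
  apply: (@mulfI _ 2) => //.
  rewrite [RHS]mulrA -(subrK t0 (_ / _)) -/t1 t10; ring.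
have TE : frx P + t0 * dx = param * (dy / dx) by rewrite t0E; field.
have eP : touch_slope (dy / dx) P.
  rewrite /touch_slope; apply: (mulfI k0); rewrite mulr0.
  move/eqP: L0; rewrite -subr_eq0 => /eqP L0.
  transitivity (- ((frx P + t0 * dx) ^+ 2 - param * (2 * (fry P + t0 * dy) + param))); last by rewrite L0 oppr0.
  by rewrite t0E; field.
exists (dy / dx); last by [].
split=> //; first by rewrite divfK.
move: eP; rewrite /touch_slope => <-.
have -> : fry Q = fry P + dy by rewrite /dy; ring.
have -> : frx Q = frx P + dx by rewrite /dx; ring.
by field.
Qed.

Lemma slope_tangent P Q s t :
  frx Q - frx P != 0 -> fry Q - fry P = s * (frx Q - frx P) ->
  touch_slope s P -> frx P + t * (frx Q - frx P) = param * s ->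
  tangent_at p P Q (along P Q t).
Proof.
set dx := frx Q - frx P => dx0 dyE; rewrite /touch_slope => eP tE.
(* Under the tangency condition the quadratic in the line parameter is a perfect square. *)
have eqn x : locus p (along P Q x) <-> ((x - t) * dx) ^+ 2 = 0.
  rewrite locusP frx_along fry_along dyE -/dx.
  have -> : frx P = param * s - t * dx by rewrite -tE; ring.
  have -> : fry P = (param * s - t * dx) * s - param * (1 + s ^+ 2) / 2.
    apply: (@mulfI _ 2) => //; rewrite -tE; move: eP => /(canRL (addrK _)) e.
    transitivity (2 * (fry P - frx P * s) + 2 * frx P * s); first by ring.
    by rewrite e; field.
  split=> [h|/eqP]; last rewrite sqrf_eq0 => /eqP h.
    transitivity ((param * s - t * dx + x * dx) ^+ 2 - param * (2 * (((param * s - t * dx) * s - param * (1 + s ^+ 2) / 2) + x * (s * dx)) + param)).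
      by field.
    by rewrite h subrr.
  have -> : param * s - t * dx + x * dx = param * s by rewrite -[RHS]addr0 -h; ring.
  have -> : x * (s * dx) = t * dx * s by rewrite -[RHS]addr0 -(mul0r s) -h; ring.
  by field.
split.
- by move=> PQ; move: dx0; rewrite /dx PQ subrr eqxx.
- apply/seteqP; split=> [_ [[x _ <-]]|_ ->]; last first.
    by split; [exists t|apply/eqn; rewrite subrr mul0r expr0n].
  move=> /eqn /eqP; rewrite sqrf_eq0 mulf_eq0 (negPf dx0) orbF subr_eq0.
  by move=> /eqP -> .
- by rewrite frx_vec.
Qed.

(** Reflecting a parametrization of the locus in the axis gives quadratic functions that satisfy the
    locus equation again; comparing coefficients leaves only the perpendicular to the directrix
    through the focus. *)
Lemma axis_frx G : axis_through p G -> frx G = 0.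
Proof.
have k0 := param_neq0.
case=> P [Q [[PQ refl] [t _ <-]]]; rewrite frx_along.
set D := dot (vec P Q) (vec P Q).
have D0 : D != 0 by rewrite gt_eqF // dot_vec_gt0.
set dx := frx Q - frx P; set dy := fry Q - fry P.
have DE : dx ^+ 2 + dy ^+ 2 = D * dot dirvec dirvec.
  by rewrite /dx /dy /frx /fry /D /cross /dot /dirvec /vec /=; ring.
have DN0 : dx ^+ 2 + dy ^+ 2 != 0 by rewrite DE mulf_neq0 // dirvec_neq0.
have tE X : dot (vec P Q) (vec P X) / D =
    (dx * (frx X - frx P) + dy * (fry X - fry P)) / (dx ^+ 2 + dy ^+ 2).
  have -> : dx * (frx X - frx P) + dy * (fry X - fry P) = dot (vec P Q) (vec P X) * dot dirvec dirvec.
    by rewrite /dx /dy /frx /fry /cross /dot /dirvec /vec /=; ring.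
  by rewrite DE; field; rewrite D0 dirvec_neq0.
have rx X : frx (reflection P Q X) = 2 * frx P - frx X +
   2 * dx * (dx * (frx X - frx P) + dy * (fry X - fry P)) / (dx ^+ 2 + dy ^+ 2).
  by rewrite /reflection frx_along /foot frx_along -/D tE; rewrite -/dx; field.
have ry X : fry (reflection P Q X) = 2 * fry P - fry X +
   2 * dy * (dx * (frx X - frx P) + dy * (fry X - fry P)) / (dx ^+ 2 + dy ^+ 2).
  by rewrite /reflection fry_along /foot fry_along -/D tE; rewrite -/dy; field.
(* The point of the locus where the tangent has slope [s]. *)
pose pt s : plane R := ((focus p).1 + (dirvec.1 * (param * s) - dirvec.2 * (param * (s ^+ 2 - 1) / 2)) / dot dirvec dirvec,
   (focus p).2 + (dirvec.2 * (param * s) + dirvec.1 * (param * (s ^+ 2 - 1) / 2)) / dot dirvec dirvec).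
have ptx s : frx (pt s) = param * s.
  have := dirvec_neq0; rewrite /frx /pt /dot /vec /= => N0; by field.
have pty s : fry (pt s) = param * (s ^+ 2 - 1) / 2.
  have := dirvec_neq0; rewrite /fry /pt /cross /dot /vec /= => N0; by field.
have inv s : frx (reflection P Q (pt s)) ^+ 2 = param * (2 * fry (reflection P Q (pt s)) + param).
  apply/locusP; rewrite -refl; exists (pt s) => //; apply/locusP.
  by rewrite ptx pty; field.
have e_neq0 := DN0; set e := dx ^+ 2 + dy ^+ 2 in rx ry e_neq0.
(* The coefficients, in powers of [s], of the frame coordinates of the reflected point. *)
have [] := @parabola_reparam R
  (dx * dy * param / e)
  (- param + 2 * dx * dx * param / e)
  (2 * frx P + 2 * dx * (- dx * frx P + dy * (- param / 2 - fry P)) / e)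
  (- param / 2 + dy * dy * param / e)
  (2 * dy * dx * param / e)
  (2 * fry P + param / 2 + 2 * dy * (- dx * frx P + dy * (- param / 2 - fry P)) / e)
  param.
  move=> s; have := inv s; rewrite rx ry ptx pty => h.
  transitivity ((2 * frx P - param * s +
     2 * dx * (dx * (param * s - frx P) + dy * (param * (s ^+ 2 - 1) / 2 - fry P)) / e) ^+ 2).
    by field.
  by rewrite h; field.
move=> /eqP; rewrite !mulf_eq0 invr_eq0 (negPf k0) (negPf e_neq0) !orbF.
(* The axis is parallel to a frame axis. If [dx = 0], the linear coefficients give [frx P = 0]; if
   [dy = 0], the reflection would reverse the opening, giving [param ^+ 2 = - param ^+ 2]. *)
case/orP=> /eqP d0.
- rewrite d0 => _; rewrite !(mulr0, mul0r) !addr0 => /eqP.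
  by rewrite mulf_eq0 oppr_eq0 (negPf k0) /= mulf_eq0 pnatr_eq0 /= => /eqP ->.
- have eE : e = dx * dx by rewrite /e d0; ring.
  have dx0 : dx != 0 by apply: contraNneq e_neq0 => dx0; rewrite eE dx0 mulr0.
  rewrite eE d0 => h _; case/negP: k0; move: h.
  have -> : - param + 2 * dx * dx * param / (dx * dx) = param by field.
  have -> : - param / 2 + 0 * 0 * param / (dx * dx) = - param / 2 by field.
  move=> h; rewrite -(@sqrf_eq0 _ param); apply/eqP.
  have : 2 * param ^+ 2 = 0 by rewrite -[LHS](addrK (param ^+ 2)) {2}h; field.
  by move/eqP; rewrite mulf_eq0 pnatr_eq0 /= => /eqP.
Qed.

Lemma frx_axis G : frx G = 0 -> axis_through p G.
Proof.
have N0 := dirvec_gt0; have N0' := dirvec_neq0.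
move=> G0; set F := focus p.
(* The focus moved by [dirvec] after a quarter turn: reflection in [F n] negates [frx] and keeps
   [fry]. *)
pose n : plane R := (F.1 - dirvec.2, F.2 + dirvec.1).
have xF : frx F = 0 by rewrite /frx /dot /vec /=; ring.
have yF : fry F = 0 by rewrite /fry /cross /vec /=; ring.
have xn : frx n = 0 by rewrite /frx /n /dot /vec /=; ring.
have yn : fry n = dot dirvec dirvec by rewrite /fry /n /cross /dot /vec /=; ring.
have vE X : vec F X = ((dirvec.1 * frx X - dirvec.2 * fry X) / dot dirvec dirvec,
     (dirvec.2 * frx X + dirvec.1 * fry X) / dot dirvec dirvec).
  by congr pair; move: N0'; rewrite /frx /fry /cross /dot /vec /= => N0'; field.
have Fn : dot (vec F n) (vec F n) = dot dirvec dirvec.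
  by rewrite /dot /vec /n /=; ring.
have tE X : dot (vec F n) (vec F X) = fry X by rewrite /fry /cross /dot /vec /n /=; ring.
have inv X : locus p X -> locus p (reflection F n X).
  move=> /locusP h; apply/locusP.
  rewrite /reflection frx_along fry_along /foot frx_along fry_along xF yF xn yn tE Fn.
  transitivity (frx X ^+ 2); first by ring.
  by rewrite h; field.
(* For an involution, mapping the locus into itself already means mapping it onto itself. *)
have invol X : reflection F n (reflection F n X) = X.
  rewrite {1}/reflection /foot tE Fn.
  have -> : fry (reflection F n X) = fry X.
    by rewrite /reflection fry_along /foot fry_along yF yn tE Fn; field.
  rewrite /reflection /foot tE Fn /along; case: X => x1 x2 /=.
  by congr pair; ring.
exists F, n; split.
- split; first by move=> h; move: N0; rewrite -Fn -h /dot /vec /= !subrr mulr0 addr0 ltxx.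
  apply/seteqP; split=> [_ [X /inv ? <-] //|X /inv LX].
  by exists (reflection F n X).
- exists (fry G / dot dirvec dirvec) => //.
  have [h1 h2] := vE G; rewrite G0 mulr0 sub0r in h1; rewrite G0 mulr0 add0r in h2.
  rewrite /along /n; case: G G0 h1 h2 => g1 g2 G0 /= h1 h2; congr pair.
    by rewrite -[RHS](subrK F.1) h1; ring.
  by rewrite -[RHS](subrK F.2) h2; ring.
Qed.
End Frame.

(** * Triangles of tangents *)

Lemma cross_frame {R : realType} (p : parabola R) (X Y Z : plane R) :
  orient X Y Z * dot (dirvec p) (dirvec p) =
  (frx p Y - frx p X) * (fry p Z - fry p X) - (fry p Y - fry p X) * (frx p Z - frx p X).
Proof. by rewrite /orient /frx /fry /dot /cross /vec /=; ring. Qed.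

(** The frame coordinates of the intersections of three tangents: [sa] is the slope of [BC], so [A]
    is where the tangents of slopes [sb] and [sc] meet. *)
Definition tangent_triangle {R : realType} (p : parabola R) (A B C : plane R) (sa sb sc : R) :=
  [/\ frx p A = param p * (sb + sc) / 2 /\ fry p A = param p * (sb * sc - 1) / 2,
      frx p B = param p * (sc + sa) / 2 /\ fry p B = param p * (sc * sa - 1) / 2 &
      frx p C = param p * (sa + sb) / 2 /\ fry p C = param p * (sa * sb - 1) / 2].

Lemma touch_slopes {R : realType} (p : parabola R) (X : plane R) (s s' : R) : s != s' ->
  touch_slope p s X -> touch_slope p s' X ->
  frx p X = param p * (s + s') / 2 /\ fry p X = param p * (s * s' - 1) / 2.
Proof.
rewrite -subr_eq0 /touch_slope => ss' h h'.
have xE : frx p X = param p * (s + s') / 2.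
  apply: (mulfI ss'); lra.
by split=> //; rewrite xE in h; lra.
Qed.

(** Each vertex lies on two tangents, which fixes its coordinates. The contact point on [BC] has
    abscissa [param p * sa], so it divides [BC] as [sa] divides the interval between [sc] and
    [sb]. *)
Lemma exparabola_tangent_triangle {R : realType} (A B C : plane R) (p : parabola R) :
  nondegenerate_triangle A B C -> exparabola A B C p -> touches_inside p B C ->
  exists sa sb sc, tangent_triangle p A B C sa sb sc /\ 0 < (sa - sb) * (sc - sa).
Proof.
move=> K0 [[TA tA] [TB tB] [TC tC]] [T [[t [t0 t1 TE]] tT]].
have [s [sE _ _] [_ sT]] := tangent_slope tT.
have [sa [aE aB aC] [a0 _]] := tangent_slope tA.
have [sb [bE bC bA] [b0 _]] := tangent_slope tB.
have [sc [cE cA cB] [c0 _]] := tangent_slope tC.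
have N0 := dirvec_neq0 p.
have /eqP D0 : orient A B C * dot (dirvec p) (dirvec p) != 0 by rewrite mulf_neq0.
(* Equal slopes would make two side lines parallel. *)
have [a_b b_c c_a] : [/\ sa != sb, sb != sc & sc != sa].
  split; apply: contra_notN D0 => /eqP e; rewrite cross_frame; subst; nra.
have [xA yA] := touch_slopes b_c bA cA.
have [xB yB] := touch_slopes c_a cB aB.
have [xC yC] := touch_slopes a_b aC bC.
exists sa, sb, sc; split=> //.
have {sE} ssa : s = sa by apply: (mulIf a0); rewrite -sE aE.
have k0 := param_neq0 p.
have e : sa - sc = t * (sb - sc).
  apply: (mulfI k0); move: sT; rewrite TE frx_along ssa xB xC => h.
  lra.
have -> : (sa - sb) * (sc - sa) = t * (1 - t) * (sb - sc) ^+ 2.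
  have -> : sa = sc + t * (sb - sc) by rewrite -e; ring.
  by ring.
apply: mulr_gt0; first by rewrite mulr_gt0 // subr_gt0.
by rewrite exprn_even_gt0 //= subr_eq0.
Qed.

Lemma tangent_triangle_rot {R : realType} (p : parabola R) (A B C : plane R) (sa sb sc : R) :
  tangent_triangle p A B C sa sb sc -> tangent_triangle p B C A sb sc sa.
Proof. by case. Qed.

Lemma tangent_triangle_tangent {R : realType} (p : parabola R) (A B C : plane R) (sa sb sc t : R) :
  sb != sc -> tangent_triangle p A B C sa sb sc -> sa - sc = t * (sb - sc) ->
  tangent_at p B C (along B C t).
Proof.
move=> b_c [_ [xB yB] [xC yC]] tE; have k0 := param_neq0 p.
have dx : frx p C - frx p B = param p * (sb - sc) / 2 by rewrite xB xC; field.
apply: (@slope_tangent _ _ _ _ sa).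
- by rewrite dx !mulf_eq0 !negb_or k0 subr_eq0 b_c invr_eq0 pnatr_eq0.
- by rewrite dx yB yC; field.
- by rewrite /touch_slope xB yB; field.
- rewrite dx xB; transitivity (param p * (sc + sa + t * (sb - sc)) / 2); first by field.
  by rewrite -tE; field.
Qed.

Lemma tangent_triangle_exparabola {R : realType} (p : parabola R) (A B C : plane R) (sa sb sc : R) :
  tangent_triangle p A B C sa sb sc -> 0 < (sa - sb) * (sc - sa) ->
  exparabola A B C p /\ touches_inside p B C.
Proof.
move=> h s0.
have a_b : sa != sb by apply: contraTneq s0 => ->; rewrite subrr mul0r ltxx.
have c_a : sc != sa by apply: contraTneq s0 => ->; rewrite subrr mulr0 ltxx.
have bc0 : sb - sc != 0.
  apply: contraTneq s0 => /subr0_eq ->; rewrite -leNgt -opprB mulNr -expr2 oppr_le0; exact: sqr_ge0.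
have b_c : sb != sc by rewrite -subr_eq0.
have hB := tangent_triangle_rot h; have hC := tangent_triangle_rot hB.
have tangentP (X Y Z : plane R) s s' s'' : s' != s'' -> tangent_triangle p X Y Z s s' s'' -> tangent p Y Z.
  move=> ne hX; exists (along Y Z ((s - s'') / (s' - s''))).
  by apply: (tangent_triangle_tangent ne hX); rewrite divfK // subr_eq0.
split; first by split; apply: tangentP; [|exact: h| |exact: hB| |exact: hC].
set t := (sa - sc) / (sb - sc); exists (along B C t); split; last first.
  by apply: (tangent_triangle_tangent b_c h); rewrite divfK.
exists t; have sq : 0 < (sb - sc) ^+ 2 by rewrite exprn_even_gt0.
have tt : 0 < t * (1 - t).
  rewrite -(pmulr_lgt0 _ sq); suff -> : t * (1 - t) * (sb - sc) ^+ 2 = (sa - sb) * (sc - sa) by [].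
  by rewrite /t; field.
by split=> //; nra.
Qed.

Lemma parabola_with_frame {R : realType} (F u : plane R) (k : R) : dot u u != 0 -> k != 0 ->
  exists p : parabola R, [/\ focus p = F, dirvec p = u & param p = k].
Proof.
case: F u => [f1 f2] [u1 u2] N0 k0; have := N0; rewrite {1}/dot /= => N0'.
(* The directrix has direction [u] and passes through [F] moved along the clockwise normal of [u] by
   the amount that makes [param] equal to [k]. *)
pose D1 : plane R := (f1 + k * u2 / (u1 * u1 + u2 * u2), f2 - k * u1 / (u1 * u1 + u2 * u2)).
pose D2 : plane R := (D1.1 + u1, D1.2 + u2).
have dE : vec D1 D2 = (u1, u2) by rewrite /vec /D2 /=; congr pair; ring.
have kE : cross (vec D1 D2) (vec D1 (f1, f2)) = k.
  by rewrite dE /cross /D1 /vec /=; field.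
have D12 : D1 <> D2.
  by move=> e; case/eqP: k0; rewrite -kE -e /cross /vec /=; ring.
have off : ~ line D1 D2 (f1, f2).
  by move=> [t _ e]; case/eqP: k0; rewrite -kE -e /cross /vec /along /=; ring.
by exists (Parabola D12 off).
Qed.

Lemma axis_centroid {R : realType} (p : parabola R) (A B C : plane R) (sa sb sc : R) :
  tangent_triangle p A B C sa sb sc ->
  axis_through p (centroid A B C) <-> sa + sb + sc = 0.
Proof.
move=> [[xA _] [xB _] [xC _]]; have k0 := param_neq0 p.
have e : frx p (centroid A B C) = param p * (sa + sb + sc) / 3.
  transitivity ((frx p A + frx p B + frx p C) / 3); last by rewrite xA xB xC; field.
  by rewrite /centroid /frx /dot /vec /=; field.
split=> [/axis_frx/eqP|h].
  by rewrite e !mulf_eq0 (negPf k0) invr_eq0 pnatr_eq0 orbF => /eqP.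
by apply: frx_axis; rewrite e h mulr0 mul0r.
Qed.

Lemma exparabola_centroid_axis_exists {R : realType} (A B C : plane R) :
  nondegenerate_triangle A B C ->
  exists p, [/\ exparabola A B C p, touches_inside p B C & axis_through p (centroid A B C)].
Proof.
pose K := orient A B C; rewrite /nondegenerate_triangle -/K => K0.
pose dB := vec C A; pose dC := vec A B; pose dA := vec B C.
(* The axis is perpendicular to [u t], where [0 < t < 1]; in the frame of [u t]
   the slope of [BC] is between those of [CA] and [AB], and their sum changes
   sign. *)
pose u (t : R) : plane R := ((t - 1) * dC.2 + t * dB.2, (1 - t) * dC.1 - t * dB.1).
pose v (d : plane R) t := cross (u t) d.
have hA t : dot (u t) dA = K by rewrite /K /orient /dot /u /dA /dB /dC /vec /=; ring.
have hB t : dot (u t) dB = - (1 - t) * K by rewrite /K /orient /dot /u /dA /dB /dC /vec /=; ring.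
have hC t : dot (u t) dC = - t * K by rewrite /K /orient /dot /u /dA /dB /dC /vec /=; ring.
have vA t : v dA t = - v dB t - v dC t by rewrite /v /cross /u /dA /dB /dC /vec /=; ring.
have NE t : dot (u t) (u t) = t * v dB t - (1 - t) * v dC t by rewrite /v /cross /dot /u /=; ring.
have [t /andP[t0 t1] tE] : exists2 t, 0 < t < 1 &
   t * (1 - t) * v dA t - t * v dB t - (1 - t) * v dC t = 0.
  have [P PE] : exists P : plane R -> {poly R}, forall d t, (P d).[t] = v d t.
    exists (fun d => - (dot dC d)%:P + (dot dC d + dot dB d)%:P * 'X) => d t.
    by rewrite !hornerE /v /cross /u /dot /=; ring.
  (* Minus the sum of the slopes, multiplied by [t * (1 - t) * K]. It is negative at 0 and positive
     at 1, so its root is interior. *)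
  pose Q : {poly R} := 'X * P dB + (1 - 'X) * P dC - 'X * (1 - 'X) * P dA.
  have QE t : Q.[t] = t * v dB t + (1 - t) * v dC t - t * (1 - t) * v dA t.
    by rewrite /Q !hornerE !PE.
  have B0 : 0 < dot dB dB.
    by apply/dot_vec_gt0 => e; case/eqP: K0; rewrite /K /orient e /vec /=; ring.
  have C0 : 0 < dot dC dC.
    by apply/dot_vec_gt0 => e; case/eqP: K0; rewrite /K /orient e /vec /=; ring.
  have Q0 : Q.[0] = - dot dC dC by rewrite QE /v /cross /dot /u /=; ring.
  have Q1 : Q.[1] = dot dB dB by rewrite QE /v /cross /dot /u /=; ring.
  have [//||t /andP[t0 t1] /rootP Qt] := @poly_ivt R Q 0 1.
    by rewrite Q0 Q1 oppr_le0 !ltW.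
  exists t.
    rewrite !lt_neqAle t0 t1 !andbT; apply/andP; split; apply/eqP => e.
      by move: Qt; rewrite -e Q0 => /eqP; rewrite oppr_eq0 gt_eqF.
    by move: Qt; rewrite e Q1 => /eqP; rewrite gt_eqF.
  by move: Qt; rewrite QE => Qt; rewrite -[RHS]oppr0 -Qt; ring.
have t0' : t != 0 by rewrite gt_eqF.
have t1' : 1 - t != 0 by rewrite gt_eqF // subr_gt0.
have N0 : dot (u t) (u t) != 0.
  apply: contra_neq K0 => /dot_eq0 e; rewrite -(hA t) e /dot /=; ring.
pose N := dot (u t) (u t).
(* Forced by the abscissa difference along [AB], which must be both [- t * K] and
   [k * (sa - sb) / 2]. *)
pose k := - 2 * t * (1 - t) * K ^+ 2 / N.
have k0 : k != 0 by rewrite /k !mulf_neq0 ?invr_eq0 ?expf_neq0 // oppr_eq0.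
pose sa := v dA t / K; pose sb := - v dB t / ((1 - t) * K); pose sc := - v dC t / (t * K).
have sab : sa - sb = N / ((1 - t) * K).
  by rewrite /N NE /sa /sb vA; field; rewrite K0 t1'.
have sca : sc - sa = N / (t * K).
  by rewrite /N NE /sa /sc vA; field; rewrite K0 t0'.
have ssum : sa + sb + sc = 0.
  transitivity ((t * (1 - t) * v dA t - t * v dB t - (1 - t) * v dC t) / (t * (1 - t) * K)).
    by rewrite /sa /sb /sc; field; rewrite K0 t0' t1'.
  by rewrite tE mul0r.
(* The focus is placed so that [A] gets the coordinates required by [tangent_triangle]; the side
   vectors then fix [B] and [C]. *)
pose al := k * (sb + sc) / 2; pose be := k * (sb * sc - 1) / 2.
pose F : plane R := (A.1 - (al * (u t).1 - be * (u t).2) / N, A.2 - (al * (u t).2 + be * (u t).1) / N).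
have [p [pF pu pk]] := parabola_with_frame F N0 k0.
have frA : frx p A = al.
  rewrite /frx pF pu; move: N0; rewrite /N /dot /vec /F /N /dot /= => N0; by field.
have fyA : fry p A = be.
  rewrite /fry pF pu; move: N0; rewrite /N /cross /vec /F /N /dot /= => N0; by field.
have dx X Y : frx p Y = frx p X + dot (u t) (vec X Y).
  by rewrite /frx pu /dot /vec /=; ring.
have dy X Y : fry p Y = fry p X + cross (u t) (vec X Y).
  by rewrite /fry pu /cross /vec /=; ring.
have hC' : dot (u t) dC = k * (sa - sb) / 2.
  by rewrite hC sab /k; field; rewrite t1' K0 N0.
have hB' : dot (u t) dB = k * (sc - sa) / 2.
  by rewrite hB sca /k; field; rewrite t0' K0 N0.
have vC' : v dC t = sc * dot (u t) dC by rewrite hC /sc; field; rewrite t0' K0.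
have vB' : v dB t = sb * dot (u t) dB by rewrite hB /sb; field; rewrite t1' K0.
have TT : tangent_triangle p A B C sa sb sc.
  rewrite /tangent_triangle pk frA fyA; split; first by [].
  - rewrite (dx A B) (dy A B) -/dC -/(v dC t) vC' hC' frA fyA /al /be; split; by field.
  - have -> : frx p C = frx p A - dot (u t) dB by rewrite (dx C A) addrK.
    have -> : fry p C = fry p A - v dB t by rewrite (dy C A) addrK.
    rewrite vB' hB' frA fyA /al /be; split; by field.
have mid : 0 < (sa - sb) * (sc - sa).
  rewrite sab sca.
  have -> : N / ((1 - t) * K) * (N / (t * K)) = N ^+ 2 / (K ^+ 2 * (t * (1 - t))).
    by field; rewrite K0 t0' t1'.
  apply: divr_gt0; first by rewrite exprn_even_gt0.
  apply: mulr_gt0; first by rewrite exprn_even_gt0.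
  by rewrite mulr_gt0 // subr_gt0.
have [h1 h2] := tangent_triangle_exparabola TT mid.
by exists p; split=> //; apply/(axis_centroid TT).
Qed.

(** * The cubic equation of the focus *)

Definition on_circle {R : realType} (O : plane R) (r2 : R) (X : plane R) : Prop :=
  dot (vec O X) (vec O X) = r2.

Definition cplx {R : realType} (O X : plane R) : R[i] := Complex (X.1 - O.1) (X.2 - O.2).

Lemma fr_dist {R : realType} (p : parabola R) (X Y : plane R) :
  dot (vec X Y) (vec X Y) * dot (dirvec p) (dirvec p) =
  (frx p Y - frx p X) ^+ 2 + (fry p Y - fry p X) ^+ 2.
Proof. by rewrite /frx /fry /dot /cross /vec /=; ring. Qed.

(** Subtracting the circle equations in pairs gives the perpendicular bisectors, linear in the
    coordinates of [O] once a difference of slopes is cancelled. That the focus lies on the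
    circumcircle is Lambert's theorem. *)
Lemma circumcenter_tangent_triangle {R : realType} (p : parabola R) (O A B C : plane R) (r2 sa sb sc : R) :
  tangent_triangle p A B C sa sb sc -> sa != sb -> sb != sc -> sc != sa ->
  on_circle O r2 A -> on_circle O r2 B -> on_circle O r2 C ->
  [/\ frx p O = param p * (sa + sb + sc - sa * sb * sc) / 4,
      fry p O = param p * (sa * sb + sb * sc + sc * sa - 1) / 4,
      r2 * dot (dirvec p) (dirvec p) =
        param p ^+ 2 * (1 + sa ^+ 2) * (1 + sb ^+ 2) * (1 + sc ^+ 2) / 16 &
      on_circle O r2 (focus p)].
Proof.
move=> [[xA yA] [xB yB] [xC yC]] ab bc ca OA OB OC.
have k0 := param_neq0 p; have N0 := dirvec_neq0 p.
have := fr_dist p O A; rewrite OA xA yA => hA.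
have := fr_dist p O B; rewrite OB xB yB => hB.
have := fr_dist p O C; rewrite OC xC yC => hC.
move: hA hB hC; set x := frx p O; set y := fry p O => hA hB hC.
have eC : 2 * (x + sc * y) = param p * (1 + sc ^+ 2) * (sa + sb) / 2.
  have ne : param p * (sa - sb) != 0 by rewrite mulf_neq0 // subr_eq0.
  apply: (mulfI ne); lra.
have eB : 2 * (x + sb * y) = param p * (1 + sb ^+ 2) * (sc + sa) / 2.
  have ne : param p * (sc - sa) != 0 by rewrite mulf_neq0 // subr_eq0.
  apply: (mulfI ne); lra.
have yE : y = param p * (sa * sb + sb * sc + sc * sa - 1) / 4.
  have ne : sb - sc != 0 by rewrite subr_eq0.
  apply: (mulfI ne); lra.
have xE : x = param p * (sa + sb + sc - sa * sb * sc) / 4 by rewrite yE in eC; lra.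
have rE : r2 * dot (dirvec p) (dirvec p) =
    param p ^+ 2 * (1 + sa ^+ 2) * (1 + sb ^+ 2) * (1 + sc ^+ 2) / 16.
  by rewrite hA xE yE; field.
split=> //; apply: (mulIf N0); rewrite fr_dist -/x -/y rE xE yE.
have -> : frx p (focus p) = 0 by rewrite /frx /dot /vec /=; ring.
have -> : fry p (focus p) = 0 by rewrite /fry /cross /vec /=; ring.
by field.
Qed.

(* The cubic of the header, multiplied by [3 * r2]. *)
Definition focus_equation {R : realType} (r2 : R) (a b c f : R[i]) : Prop :=
  3 * r2%:C%C * (f ^+ 3 + a * b * c) =
  r2%:C%C * (a + b + c) * f ^+ 2 + a * b * c * (a + b + c)^*%C * f.

(** The change to the frame of [p] is a complex multiplication, since [conj(u) z] has real part
    [dot u z] and imaginary part [cross u z]. *)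
Lemma cplx_fr {R : realType} (p : parabola R) (X Y : plane R) :
  (Complex (dirvec p).1 (dirvec p).2)^*%C * cplx X Y =
  Complex (frx p Y - frx p X) (fry p Y - fry p X).
Proof.
by apply/eqP; rewrite eq_complex /= /frx /fry /dot /cross /vec /=; apply/andP; split; apply/eqP; ring.
Qed.

(* Here [w1], [w2], [w3] are [1 + i s] for the three slopes [s], so that the conjugate
   of [w] is [2 - w]; [k] is imaginary, and [a'], [b'], [c'] are the conjugates of
   [a], [b], [c]. *)
Lemma focus_equation_frame {R : comPzRingType} (k w1 w2 : R) :
  let w3 := 3 - w1 - w2 in
  let f := k * w1 * w2 * w3 in
  let a := - k * w2 * w3 * (2 - w1) in
  let b := - k * w3 * w1 * (2 - w2) in
  let c := - k * w1 * w2 * (2 - w3) in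
  let a' := k * (2 - w2) * (2 - w3) * w1 in
  let b' := k * (2 - w3) * (2 - w1) * w2 in
  let c' := k * (2 - w1) * (2 - w2) * w3 in
  let r2 := - k ^+ 2 * (w1 * w2 * w3) * ((2 - w1) * (2 - w2) * (2 - w3)) in
  3 * r2 * (f ^+ 3 + a * b * c) = r2 * (a + b + c) * f ^+ 2 + a * b * c * (a' + b' + c') * f.
Proof. by move=> /=; ring. Qed.

Lemma tangent_triangle_focus_equation {R : realType} (p : parabola R) (O A B C : plane R) (r2 sa sb sc : R) :
  tangent_triangle p A B C sa sb sc -> sa != sb -> sb != sc -> sc != sa -> sa + sb + sc = 0 ->
  on_circle O r2 A -> on_circle O r2 B -> on_circle O r2 C ->
  focus_equation r2 (cplx O A) (cplx O B) (cplx O C) (cplx O (focus p)).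
Proof.
move=> TT ab bc ca s0 OA OB OC.
have [xO yO rE _] := circumcenter_tangent_triangle TT ab bc ca OA OB OC.
case: TT => [[xA yA] [xB yB] [xC yC]].
set v := (Complex (dirvec p).1 (dirvec p).2)^*%C.
have vA : v * cplx O A = _ := cplx_fr p O A.
have vB : v * cplx O B = _ := cplx_fr p O B.
have vC : v * cplx O C = _ := cplx_fr p O C.
have vF : v * cplx O (focus p) = _ := cplx_fr p O (focus p).
have F1 : frx p (focus p) = 0 by rewrite /frx /dot /vec /=; ring.
have F2 : fry p (focus p) = 0 by rewrite /fry /cross /vec /=; ring.
move: vA vB vC vF; rewrite xA yA xB yB xC yC xO yO F1 F2.
pose w1 := Complex 1 sa; pose w2 := Complex 1 sb; pose w3 : R[i] := 3 - w1 - w2.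
pose k := Complex 0 (param p / 4).
(* The axis condition enters here: with slope sum 0, [w3] is [1 + i sc]. *)
have s3 : sc = - sa - sb by rewrite -[RHS]addr0 -s0; ring.
have w3E : w3 = Complex 1 sc.
  by apply/eqP; rewrite eq_complex /= s3; apply/andP; split; apply/eqP; ring.
move=> vA vB vC vF.
have {}vA : v * cplx O A = - k * w2 * w3 * (2 - w1).
  by rewrite vA w3E; apply/eqP; rewrite eq_complex /=; apply/andP; split; apply/eqP; field.
have {}vB : v * cplx O B = - k * w3 * w1 * (2 - w2).
  by rewrite vB w3E; apply/eqP; rewrite eq_complex /=; apply/andP; split; apply/eqP; field.
have {}vC : v * cplx O C = - k * w1 * w2 * (2 - w3).
  by rewrite vC w3E; apply/eqP; rewrite eq_complex /=; apply/andP; split; apply/eqP; field.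
have {}vF : v * cplx O (focus p) = k * w1 * w2 * w3.
  by rewrite vF w3E; apply/eqP; rewrite eq_complex /=; apply/andP; split; apply/eqP; field.
have kJ : k^*%C = - k by apply/eqP; rewrite eq_complex /= oppr0 !eqxx.
have wJ s : (Complex 1 s)^*%C = 2 - Complex 1 s :> R[i].
  by apply/eqP; rewrite eq_complex /=; apply/andP; split; apply/eqP; ring.
have w3J : w3^*%C = 2 - w3 by rewrite w3E wJ.
have conjM (x y : R[i]) : (x * y)^*%C = x^*%C * y^*%C by rewrite rmorphM.
have conjN (x : R[i]) : (- x)^*%C = - x^*%C by rewrite rmorphN.
have conjB2 (x : R[i]) : (2 - x)^*%C = 2 - x^*%C by rewrite rmorphB; congr (_ - _); exact: conjc_nat.
have uA : v^*%C * (cplx O A)^*%C = k * (2 - w2) * (2 - w3) * w1.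
  by rewrite -conjM vA !(conjM, conjB2, conjN) kJ w3J !wJ -/w1 -/w2; ring.
have uB : v^*%C * (cplx O B)^*%C = k * (2 - w3) * (2 - w1) * w2.
  by rewrite -conjM vB !(conjM, conjB2, conjN) kJ w3J !wJ -/w1 -/w2; ring.
have uC : v^*%C * (cplx O C)^*%C = k * (2 - w1) * (2 - w2) * w3.
  by rewrite -conjM vC !(conjM, conjB2, conjN) kJ w3J !wJ -/w1 -/w2; ring.
have rr : v * v^*%C * r2%:C%C = - k ^+ 2 * (w1 * w2 * w3) * ((2 - w1) * (2 - w2) * (2 - w3)).
  transitivity ((r2 * dot (dirvec p) (dirvec p))%:C%C).
    by apply/eqP; rewrite /v eq_complex /dot /dirvec /vec /=; apply/andP; split; apply/eqP; ring.
  by rewrite rE w3E; apply/eqP; rewrite eq_complex /=; apply/andP; split; apply/eqP; field.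
have v0 : v != 0.
  rewrite conjc_eq0 eq_complex /=; apply/negP => /andP[/eqP h1 /eqP h2].
  by have := dirvec_neq0 p; rewrite /dot /dirvec /vec /= h1 h2 mulr0 addr0 eqxx.
have := focus_equation_frame k w1 w2; rewrite /= -/w3 -vA -vB -vC -vF -uA -uB -uC -rr => E.
(* The focus equation is homogeneous: passing to the frame multiplies every term by this factor. *)
have v0' : v ^+ 4 * v^*%C != 0 by rewrite mulf_eq0 expf_eq0 /= (conjc_eq0 v) negb_or v0.
have conjD (x y : R[i]) : (x + y)^*%C = x^*%C + y^*%C by rewrite rmorphD.
apply: (mulfI v0'); rewrite !conjD.
move: E; set a := cplx O A; set b := cplx O B; set c := cplx O C; set f := cplx O (focus p).
set v' := v^*%C; set a' := a^*%C; set b' := b^*%C; set c' := c^*%C => E.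
transitivity (3 * (v * v' * r2%:C%C) *
  ((v * f) ^+ 3 + v * a * (v * b) * (v * c))); first by ring.
by rewrite E; ring.
Qed.

(** In the frame the focus is the origin, and the product is a negative multiple of [(1 + sa ^+ 2) *
    (sb - sc) ^+ 2 * (sa - sb) * (sc - sa)]. *)
Lemma tangent_triangle_opposite_side {R : realType} (p : parabola R) (A B C : plane R) (sa sb sc : R) :
  tangent_triangle p A B C sa sb sc -> 0 < (sa - sb) * (sc - sa) ->
  orient (focus p) B C * orient A B C < 0.
Proof.
move=> [[xA yA] [xB yB] [xC yC]] s0.
have k0 := param_neq0 p; have N0 := dirvec_neq0 p.
have F1 : frx p (focus p) = 0 by rewrite /frx /dot /vec /=; ring.
have F2 : fry p (focus p) = 0 by rewrite /fry /cross /vec /=; ring.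
have e1 := cross_frame p (focus p) B C; have e2 := cross_frame p A B C.
have bc0 : sb - sc != 0.
  apply: contraTneq s0 => /subr0_eq ->; rewrite -leNgt -opprB mulNr -expr2 oppr_le0; exact: sqr_ge0.
have N2 : 0 < dot (dirvec p) (dirvec p) ^+ 2 by rewrite exprn_even_gt0.
rewrite -(pmulr_rlt0 _ N2).
have -> : dot (dirvec p) (dirvec p) ^+ 2 * (orient (focus p) B C * orient A B C) =
   (orient (focus p) B C * dot (dirvec p) (dirvec p)) * (orient A B C * dot (dirvec p) (dirvec p)) by ring.
rewrite e1 e2 F1 F2 xA yA xB yB xC yC.
set k := param p in k0 *.
have P1 : 0 < (k ^+ 2 * (sb - sc)) ^+ 2 by rewrite exprn_even_gt0 //= mulf_neq0 // expf_neq0.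
have P2 : 0 < 1 + sa ^+ 2 by rewrite ltr_wpDr ?sqr_ge0.
have P3 := mulr_gt0 (mulr_gt0 P1 P2) s0.
have h16 : 0 < 16 :> R by rewrite ltr0n.
rewrite -oppr_gt0 -(pmulr_lgt0 _ h16).
apply: (lt_le_trans P3); rewrite le_eqVlt; apply/orP; left; apply/eqP; by field.
Qed.

(** What the iteration retains of the parabola. The first two clauses place [F] on the arc [BC] not
    containing [A]. *)
Definition opposite_focus_spec {R : realType} (O : plane R) (r2 : R) (A B C F : plane R) : Prop :=
  [/\ on_circle O r2 F, orient F B C * orient A B C < 0 &
      focus_equation r2 (cplx O A) (cplx O B) (cplx O C) (cplx O F)].

Lemma opposite_focusP {R : realType} (O : plane R) (r2 : R) (A B C : plane R) :
  nondegenerate_triangle A B C ->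
  on_circle O r2 A -> on_circle O r2 B -> on_circle O r2 C ->
  opposite_focus_spec O r2 A B C (opposite_focus (centroid A B C) A B C).
Proof.
move=> K0 OA OB OC.
(* As the set is inhabited, [get] returns one of its elements and not the default value. *)
have [p [<- ep tp ap]] : [set F | exists p : parabola R,
    [/\ focus p = F, exparabola A B C p, touches_inside p B C
      & axis_through p (centroid A B C)]] (opposite_focus (centroid A B C) A B C).
  apply: getPex; have [p [h1 h2 h3]] := exparabola_centroid_axis_exists K0.
  by exists (focus p), p.
have [sa [sb [sc [TT s0]]]] := exparabola_tangent_triangle K0 ep tp.
have ssum := (axis_centroid TT).1 ap.
have ab : sa != sb by apply: contraTneq s0 => ->; rewrite subrr mul0r ltxx.
have ca : sc != sa by apply: contraTneq s0 => ->; rewrite subrr mulr0 ltxx.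
have bc : sb != sc.
  rewrite -subr_eq0; apply: contraTneq s0 => /subr0_eq ->.
  by rewrite -leNgt -opprB mulNr -expr2 oppr_le0 sqr_ge0.
have [_ _ _ OF] := circumcenter_tangent_triangle TT ab bc ca OA OB OC.
split=> //; first exact: tangent_triangle_opposite_side TT s0.
exact: (tangent_triangle_focus_equation TT).
Qed.

(** * One step of the iteration *)

Definition sqnorm {R : realType} (z : R[i]) : R := complex.Re z ^+ 2 + complex.Im z ^+ 2.

Lemma sqnorm_ge0 {R : realType} (z : R[i]) : 0 <= sqnorm z.
Proof. by rewrite addr_ge0 ?sqr_ge0. Qed.

Lemma sqnormM {R : realType} (z w : R[i]) : sqnorm (z * w) = sqnorm z * sqnorm w.
Proof. by case: z w => [a b] [c d]; rewrite /sqnorm /=; ring. Qed.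

Lemma sqnormJ {R : realType} (z : R[i]) : sqnorm z^*%C = sqnorm z.
Proof. by case: z => a b; rewrite /sqnorm /= sqrrN. Qed.

Lemma sqnormC {R : realType} (x : R) : sqnorm x%:C%C = x ^+ 2.
Proof. by rewrite /sqnorm /=; ring. Qed.

Lemma sqnormD_le {R : realType} (z w : R[i]) : sqnorm (z + w) <= 2 * (sqnorm z + sqnorm w).
Proof.
case: z w => [a b] [c d]; rewrite /sqnorm /= -subr_ge0.
have -> : 2 * (a ^+ 2 + b ^+ 2 + (c ^+ 2 + d ^+ 2)) - ((a + c) ^+ 2 + (b + d) ^+ 2) =
  (a - c) ^+ 2 + (b - d) ^+ 2 by ring.
by rewrite addr_ge0 ?sqr_ge0.
Qed.

Lemma mulcJ {R : realType} (z : R[i]) : z * z^*%C = (sqnorm z)%:C%C.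
Proof.
by case: z => a b; apply/eqP; rewrite eq_complex /sqnorm /=; apply/andP; split; apply/eqP; ring.
Qed.

(** * Points, chords and triangles on a circle *)

Lemma on_circle_sqnorm {R : realType} (O : plane R) (r2 : R) (X : plane R) :
  on_circle O r2 X <-> sqnorm (cplx O X) = r2.
Proof. by rewrite /on_circle /sqnorm /cplx /dot /vec /= -!expr2. Qed.

Lemma on_circle_chord {R : realType} (O X Y : plane R) (r2 : R) :
  on_circle O r2 X -> on_circle O r2 Y ->
  dot (vec X Y) (vec X Y) = 2 * dot (vec X Y) (vec X O).
Proof. rewrite /on_circle /dot /vec /= => <- h; lra. Qed.

(** On the circle, squared distance from [C] is a linear function of the vector from [C], so it can
    be applied to the barycentric expression of [F]. *)
Lemma on_circle_barycentric {R : realType} (O A B C F : plane R) (r2 : R) :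
  on_circle O r2 A -> on_circle O r2 B -> on_circle O r2 C -> on_circle O r2 F ->
  orient A B C * dot (vec C F) (vec C F) =
  orient F B C * dot (vec C A) (vec C A) + orient F C A * dot (vec C B) (vec C B).
Proof.
move=> OA OB OC OF; rewrite !(on_circle_chord OC) //.
by rewrite /orient /dot /vec /=; ring.
Qed.

Lemma orient_rot {R : realType} (A B C : plane R) : orient B C A = orient A B C.
Proof. by rewrite /orient /vec /=; ring. Qed.

(** A common focus would have negative barycentric coordinates at both [A] and [B], which makes its
    squared distance from [C] negative. *)
Lemma opposite_foci_neq {R : realType} (O A B C F F' : plane R) (r2 : R) :
  on_circle O r2 A -> on_circle O r2 B -> on_circle O r2 C -> on_circle O r2 F ->
  orient F B C * orient A B C < 0 -> orient F' C A * orient B C A < 0 -> F <> F'.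
Proof.
move=> OA OB OC OF hF hF' e; rewrite -e (orient_rot A B C) in hF'.
have E := on_circle_barycentric OA OB OC OF.
have CA : C <> A by move=> e'; move: hF; rewrite e' /orient /vec /= !subrr; lra.
have CB : C <> B by move=> e'; move: hF; rewrite e' /orient /vec /=; lra.
have h1 := dot_vec_gt0 CA; have h2 := dot_vec_gt0 CB; have h3 := dot_ge0 (vec C F).
have : 0 <= orient A B C ^+ 2 * dot (vec C F) (vec C F) by rewrite mulr_ge0 ?sqr_ge0.
rewrite expr2 -mulrA E leNgt => /negP; apply.
have -> : orient A B C * (orient F B C * dot (vec C A) (vec C A) + orient F C A * dot (vec C B) (vec C B)) =
  (orient F B C * orient A B C) * dot (vec C A) (vec C A) + (orient F C A * orient A B C) * dot (vec C B) (vec C B) by ring.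
have a1 : orient F B C * orient A B C * dot (vec C A) (vec C A) < 0 by rewrite pmulr_llt0.
have a2 : orient F C A * orient A B C * dot (vec C B) (vec C B) < 0 by rewrite pmulr_llt0.
lra.
Qed.

(** The vector [|AB|^2 AC - |AC|^2 AB] vanishes for collinear points of the circle, but its squared
    length is the product of the squared side lengths. *)
Lemma on_circle_nondegenerate {R : realType} (O A B C : plane R) (r2 : R) :
  on_circle O r2 A -> on_circle O r2 B -> on_circle O r2 C ->
  A <> B -> B <> C -> C <> A -> nondegenerate_triangle A B C.
Proof.
move=> OA OB OC AB BC CA; apply/eqP => K0.
have hB := on_circle_chord OA OB; have hC := on_circle_chord OA OC.
have AC : A <> C by move=> e; apply: CA.
have := mulr_gt0 (mulr_gt0 (dot_vec_gt0 AB) (dot_vec_gt0 AC)) (dot_vec_gt0 BC).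
suff -> : dot (vec A B) (vec A B) * dot (vec A C) (vec A C) * dot (vec B C) (vec B C) = 0 by rewrite ltxx.
have e1 : dot (vec A B) (vec A B) * (vec A C).1 - dot (vec A C) (vec A C) * (vec A B).1 = 0.
  rewrite hB hC; transitivity (orient A B C * (-2 * (vec A O).2)); last by rewrite K0 mul0r.
  by rewrite /orient /dot; ring.
have e2 : dot (vec A B) (vec A B) * (vec A C).2 - dot (vec A C) (vec A C) * (vec A B).2 = 0.
  rewrite hB hC; transitivity (orient A B C * (2 * (vec A O).1)); last by rewrite K0 mul0r.
  by rewrite /orient /dot; ring.
transitivity ((dot (vec A B) (vec A B) * (vec A C).1 - dot (vec A C) (vec A C) * (vec A B).1) ^+ 2 +
 (dot (vec A B) (vec A B) * (vec A C).2 - dot (vec A C) (vec A C) * (vec A B).2) ^+ 2).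
  by rewrite /dot /vec /=; ring.
by rewrite e1 e2 expr0n addr0.
Qed.

(** Vieta's formula, obtained by taking divided differences twice. *)
Lemma cubic_roots_sum {K : idomainType} (u s q m x y z : K) :
  u * x ^+ 3 + m = s * x ^+ 2 + q * x -> u * y ^+ 3 + m = s * y ^+ 2 + q * y ->
  u * z ^+ 3 + m = s * z ^+ 2 + q * z ->
  x != y -> y != z -> z != x -> u * (x + y + z) = s.
Proof.
rewrite -(subr_eq0 x) -(subr_eq0 y) -(subr_eq0 z) => hx hy hz xy yz zx.
have quot a b : a - b != 0 -> u * a ^+ 3 + m = s * a ^+ 2 + q * a ->
    u * b ^+ 3 + m = s * b ^+ 2 + q * b -> u * (a ^+ 2 + a * b + b ^+ 2) = s * (a + b) + q.
  move=> ab ha hb; apply: (mulfI ab).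
  transitivity ((u * a ^+ 3 + m) - (u * b ^+ 3 + m)); first by ring.
  by rewrite ha hb; ring.
have h1 := quot _ _ xy hx hy; have h2 := quot _ _ zx hz hx.
apply: (mulfI yz).
transitivity (u * (x ^+ 2 + x * y + y ^+ 2) - u * (z ^+ 2 + z * x + x ^+ 2)); first by ring.
by rewrite h1 h2; ring.
Qed.

Lemma focus_equation_rot {R : realType} (r2 : R) (a b c f : R[i]) :
  focus_equation r2 b c a f -> focus_equation r2 a b c f.
Proof.
rewrite /focus_equation => h.
have -> : a * b * c = b * c * a by ring.
have -> : a + b + c = b + c + a by ring.
exact: h.
Qed.

Lemma cplx_inj {R : realType} (O X Y : plane R) : cplx O X = cplx O Y -> X = Y.
Proof.
case: X Y => [x1 x2] [y1 y2] /eqP; rewrite eq_complex /= => /andP[/eqP/addIr -> /eqP/addIr ->] //.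
Qed.

(** The focus equation is symmetric in the vertices, so the foci are three distinct roots of one
    cubic, whose coefficients give their sum. *)
Lemma focal_triangle_step {R : realType} (O A B C FA FB FC : plane R) (r2 : R) :
  nondegenerate_triangle A B C ->
  on_circle O r2 A -> on_circle O r2 B -> on_circle O r2 C ->
  opposite_focus_spec O r2 A B C FA -> opposite_focus_spec O r2 B C A FB ->
  opposite_focus_spec O r2 C A B FC ->
  nondegenerate_triangle FA FB FC /\
  3 * (cplx O FA + cplx O FB + cplx O FC) = cplx O A + cplx O B + cplx O C.
Proof.
move=> K0 OA OB OC [OFA sA eA] [OFB sB eB] [OFC sC eC].
have AB := opposite_foci_neq OA OB OC OFA sA sB.
have BC := opposite_foci_neq OB OC OA OFB sB sC.
have CA := opposite_foci_neq OC OA OB OFC sC sA.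
split; first exact: (on_circle_nondegenerate OFA OFB OFC).
have r0 : r2%:C%C != 0 :> R[i].
  rewrite eq_complex /= eqxx andbT; apply/eqP => r0.
  have ctr X : on_circle O r2 X -> X = O.
    rewrite /on_circle r0 => /dot_eq0 [/subr0_eq h1 /subr0_eq h2].
    by case: X O h1 h2 {OA OB OC OFA OFB OFC eA eB eC} => [? ?] [? ?] /= -> ->.
  by apply: AB; rewrite (ctr _ OFA) (ctr _ OFB).
apply: (mulfI r0); rewrite mulrCA mulrA.
apply: (@cubic_roots_sum _ _ _ (cplx O A * cplx O B * cplx O C * (cplx O A + cplx O B + cplx O C)^*%C)
   (3 * r2%:C%C * (cplx O A * cplx O B * cplx O C))).
- by rewrite -mulrDr.
- by rewrite -mulrDr; exact: (focus_equation_rot eB).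
- by rewrite -mulrDr; exact: (focus_equation_rot (focus_equation_rot eC)).
- by apply/eqP => /cplx_inj.
- by apply/eqP => /cplx_inj.
- by apply/eqP => /cplx_inj.
Qed.

(** The inscribed angle theorem with signs: the cotangent of the directed angle at [X] over the
    chord [BC] does not depend on [X]. *)
Lemma inscribed_angle {R : realType} (O B C X : plane R) (r2 : R) :
  on_circle O r2 B -> on_circle O r2 C -> on_circle O r2 X ->
  dot (vec B C) (vec B C) * dot (vec X B) (vec X C) = 2 * orient O B C * orient X B C.
Proof.
move=> OB OC OX; have hB := on_circle_chord OX OB; have hC := on_circle_chord OX OC.
set p := vec X B in hB *; set q := vec X C in hC *; set o := vec X O in hB hC.
have -> : dot (vec B C) (vec B C) = dot p p + dot q q - 2 * dot p q by rewrite /dot /vec /=; ring.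
have -> : orient O B C = cross p q - cross p o - cross o q by rewrite /orient /cross /vec /=; ring.
have -> : orient X B C = cross p q by [].
have e1 : 2 * cross p q * cross p o = dot p p * dot q q - dot p p * dot p q.
  transitivity (dot p p * (2 * dot q o) - (2 * dot p o) * dot p q); first by rewrite /cross /dot; ring.
  by rewrite -hB -hC.
have e2 : 2 * cross p q * cross o q = dot p p * dot q q - dot p q * dot q q.
  transitivity ((2 * dot p o) * dot q q - dot p q * (2 * dot q o)); first by rewrite /cross /dot; ring.
  by rewrite -hB -hC.
transitivity (2 * cross p q ^+ 2 - 2 * cross p q * cross p o - 2 * cross p q * cross o q); last by ring.
by rewrite e1 e2 /cross /dot; ring.
Qed.

(* If the triangle is nearly equilateral, then its angle at [A] is acute, so the
   angle at [F] in [FBC] is obtuse and [BC] is the longest side of [FBC]. *)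
Lemma opposite_arc_bound {R : realType} (O A B C F : plane R) (r2 : R) :
  on_circle O r2 A -> on_circle O r2 B -> on_circle O r2 C -> on_circle O r2 F ->
  orient F B C * orient A B C < 0 ->
  20 * sqnorm (cplx O A + cplx O B + cplx O C) <= r2 ->
  r2 <= 4 * sqnorm (cplx O F + cplx O B) /\ r2 <= 4 * sqnorm (cplx O F + cplx O C).
Proof.
move=> OA OB OC OF side small.
have B_C : B <> C by move=> e; move: side; rewrite e /orient /vec /=; lra.
have BC0 := dot_vec_gt0 B_C.
have iA := inscribed_angle OB OC OA; have iF := inscribed_angle OB OC OF.
have r0 : 0 < r2.
  rewrite lt_neqAle -{2}OA dot_ge0 andbT; apply/eqP => r0.
  move: OB OC; rewrite /on_circle -r0 => /dot_eq0 [/subr0_eq h1 /subr0_eq h2] /dot_eq0 [/subr0_eq h3 /subr0_eq h4].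
  by apply: B_C; case: B C h1 h2 h3 h4 {iA iF BC0 side small} => [? ?] [? ?] /= -> -> -> ->.
have small' : 20 * ((A.1 - O.1 + (B.1 - O.1) + (C.1 - O.1)) ^+ 2 + (A.2 - O.2 + (B.2 - O.2) + (C.2 - O.2)) ^+ 2) <= r2 by [].
(* With position vectors [a], [b], [c] from [O] and sum [s], this product equals
   [|b + c|^2 + (r2 - |s|^2) / 2]. *)
have acute : 0 < dot (vec A B) (vec A C).
  have h1 := sqr_ge0 (A.1 - O.1 + (B.1 - O.1) + 2 * (C.1 - O.1)).
  have h2 := sqr_ge0 (A.2 - O.2 + (B.2 - O.2) + 2 * (C.2 - O.2)).
  have h3 := sqr_ge0 (A.1 - O.1 + 2 * (B.1 - O.1) + (C.1 - O.1)).
  have h4 := sqr_ge0 (A.2 - O.2 + 2 * (B.2 - O.2) + (C.2 - O.2)).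
  have h5 := sqr_ge0 (A.1 - O.1 + 2 * (B.1 - O.1) + 2 * (C.1 - O.1)).
  have h6 := sqr_ge0 (A.2 - O.2 + 2 * (B.2 - O.2) + 2 * (C.2 - O.2)).
  move: OA OB OC small' r0 h1 h2 h3 h4 h5 h6; rewrite /on_circle /dot /vec /=.
  set a1 := A.1 - O.1; set a2 := A.2 - O.2; set b1 := B.1 - O.1; set b2 := B.2 - O.2.
  set c1 := C.1 - O.1; set c2 := C.2 - O.2 => OA' OB' OC' small' r0 h1 h2 h3 h4 h5 h6.
  have -> : B.1 - A.1 = b1 - a1 by rewrite /b1 /a1; ring.
  have -> : B.2 - A.2 = b2 - a2 by rewrite /b2 /a2; ring.
  have -> : C.1 - A.1 = c1 - a1 by rewrite /c1 /a1; ring.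
  have -> : C.2 - A.2 = c2 - a2 by rewrite /c2 /a2; ring.
  lra.
(* The inscribed angle relations at [A] and at [F] are multiplied; their right sides have opposite
   signs or vanish. *)
have obtuse : dot (vec F B) (vec F C) <= 0.
  have : dot (vec B C) (vec B C) ^+ 2 * (dot (vec A B) (vec A C) * dot (vec F B) (vec F C)) <= 0.
    have -> : dot (vec B C) (vec B C) ^+ 2 * (dot (vec A B) (vec A C) * dot (vec F B) (vec F C)) =
      (2 * orient O B C) ^+ 2 * (orient F B C * orient A B C).
      transitivity ((dot (vec B C) (vec B C) * dot (vec A B) (vec A C)) *
        (dot (vec B C) (vec B C) * dot (vec F B) (vec F C))); first by ring.
      by rewrite iA iF; ring.
    by rewrite mulr_ge0_le0 ?sqr_ge0 // ltW.
  by rewrite pmulr_rle0 ?exprn_even_gt0 ?gt_eqF //= pmulr_rle0.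
(* Since [|FB| <= |BC|], [|f + b|^2 = 4 r2 - |FB|^2 >= 4 r2 - |BC|^2 = |b + c|^2]; the squares in
   [h1] and [h2] give [|b + c|^2 >= r2 / 2 - |s|^2]. *)
have h1 := sqr_ge0 (A.1 - O.1 + 2 * (B.1 - O.1) + 2 * (C.1 - O.1)).
have h2 := sqr_ge0 (A.2 - O.2 + 2 * (B.2 - O.2) + 2 * (C.2 - O.2)).
have hB := dot_ge0 (vec F B); have hC := dot_ge0 (vec F C).
move: OA OB OC OF small' r0 h1 h2 hB hC obtuse; rewrite /on_circle /sqnorm /cplx /dot /vec /=.
set a1 := A.1 - O.1; set a2 := A.2 - O.2; set b1 := B.1 - O.1; set b2 := B.2 - O.2.
set c1 := C.1 - O.1; set c2 := C.2 - O.2; set f1 := F.1 - O.1; set f2 := F.2 - O.2.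
have -> : B.1 - F.1 = b1 - f1 by rewrite /b1 /f1; ring.
have -> : B.2 - F.2 = b2 - f2 by rewrite /b2 /f2; ring.
have -> : C.1 - F.1 = c1 - f1 by rewrite /c1 /f1; ring.
have -> : C.2 - F.2 = c2 - f2 by rewrite /c2 /f2; ring.
move=> OA' OB' OC' OF' small' r0' h1 h2 hB hC obtuse.
by split; lra.
Qed.

(** The focus equation and [r2 (ab + bc + ca) = abc conj(s)] turn [3 r2 (f + a)(f + b)(f + c)] into
    [4 t] with [|t|^2 <= 4 r2^4 |s|^2]. As [|f + b|^2] and [|f + c|^2] are at least [r2 / 4], the
    constant is [1024 / 9 < 114]. *)
Lemma focal_triangle_contraction {R : realType} (O A B C F : plane R) (r2 : R) :
  on_circle O r2 A -> on_circle O r2 B -> on_circle O r2 C ->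
  opposite_focus_spec O r2 A B C F ->
  20 * sqnorm (cplx O A + cplx O B + cplx O C) <= r2 ->
  sqnorm (cplx O F + cplx O A) <= 114 * sqnorm (cplx O A + cplx O B + cplx O C).
Proof.
move=> OA OB OC [OF side eF] small.
have [fb fc] := opposite_arc_bound OA OB OC OF side small.
have r0 : 0 < r2.
  have : 0 <= r2 by rewrite -OA dot_ge0.
  rewrite le_eqVlt => /orP[/eqP r0|//].
  move: side OA OB; rewrite /on_circle -r0 => side /dot_eq0 [/subr0_eq h1 /subr0_eq h2] /dot_eq0 [/subr0_eq h3 /subr0_eq h4].
  by move: side; rewrite /orient /vec /= h1 h2 h3 h4 !subrr !mul0r subrr mulr0 ltxx.
move: OA OB OC OF => /on_circle_sqnorm OA /on_circle_sqnorm OB /on_circle_sqnorm OC /on_circle_sqnorm OF.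
move: eF fb fc small OA OB OC OF; rewrite /focus_equation.
set a := cplx O A; set b := cplx O B; set c := cplx O C; set f := cplx O F.
set S := a + b + c => eF fb fc small OA OB OC OF.
pose t := r2%:C%C * S * f ^+ 2 + a * b * c * S^*%C * f.
have SJ : S^*%C = a^*%C + b^*%C + c^*%C by rewrite /S !rmorphD.
have tE : 3 * r2%:C%C * ((f + a) * (f + b) * (f + c)) = 4 * t.
  have E2 : r2%:C%C * (a * b + b * c + c * a) = a * b * c * S^*%C.
    rewrite SJ; transitivity ((c * c^*%C) * (a * b) + (a * a^*%C) * (b * c) + (b * b^*%C) * (c * a)).
      by rewrite !mulcJ OA OB OC; ring.
    by ring.
  transitivity (3 * r2%:C%C * (f ^+ 3 + a * b * c) + 3 * (r2%:C%C * S * f ^+ 2 + r2%:C%C * (a * b + b * c + c * a) * f)).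
    by rewrite /S; ring.
  by rewrite eF E2 -/t; ring.
have tN : sqnorm t <= 4 * r2 ^+ 4 * sqnorm S.
  apply: (le_trans (sqnormD_le _ _)).
  rewrite !expr2 !sqnormM sqnormC sqnormJ OA OB OC OF.
  rewrite le_eqVlt; apply/orP; left; apply/eqP; ring.
have cN (n : nat) : sqnorm (n%:R : R[i]) = n%:R ^+ 2.
  by rewrite -sqnormC; congr sqnorm; rewrite -(rmorph_nat (real_complex R)).
have := congr1 sqnorm tE; rewrite !sqnormM !cN sqnormC => E.
set x := sqnorm (f + a) in E *; set y := sqnorm (f + b) in E fb; set z := sqnorm (f + c) in E fc.
have x0 : 0 <= x := sqnorm_ge0 _; have S0 := sqnorm_ge0 S.
have yz : r2 ^+ 2 <= 16 * (y * z).
  have -> : 16 * (y * z) = (4 * y) * (4 * z) by ring.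
  by rewrite expr2 ler_pM // ltW.
have r2p : 0 < r2 ^+ 2 by rewrite exprn_gt0.
have r4p : 0 < r2 ^+ 4 by rewrite exprn_gt0.
have h : x * r2 ^+ 2 <= x * (16 * (y * z)) by rewrite ler_wpM2l.
have h' : r2 ^+ 2 * (x * r2 ^+ 2) <= r2 ^+ 2 * (x * (16 * (y * z))) by rewrite ler_pM2l.
have r4S : 0 <= r2 ^+ 4 * sqnorm S by rewrite mulr_ge0 // ltW.
rewrite -(ler_pM2l r4p).
lra.
Qed.

(** * Regular hexagons *)

Definition hexagon {R : realType} (P0 P1 P2 P3 P4 P5 : plane R) (i : 'I_6) : plane R :=
  nth P0 [:: P0; P1; P2; P3; P4; P5] i.

Lemma range_hexagon {R : realType} (P0 P1 P2 P3 P4 P5 : plane R) :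
  range (hexagon P0 P1 P2 P3 P4 P5) = [set P0; P1; P2; P3; P4; P5].
Proof.
apply/seteqP; split=> [_ [[[|[|[|[|[|[|//]]]]]] ?] _ <-]|X /=]; rewrite /hexagon /=.
- by do 5 left.
- by do 4 left; right.
- by do 3 left; right.
- by do 2 left; right.
- by left; right.
- by right.
- move=> [[[[[->|->]|->]|->]|->]|->].
  + by exists (@Ordinal 6 0 isT).
  + by exists (@Ordinal 6 1 isT).
  + by exists (@Ordinal 6 2 isT).
  + by exists (@Ordinal 6 3 isT).
  + by exists (@Ordinal 6 4 isT).
  + by exists (@Ordinal 6 5 isT).
Qed.

Definition offset {R : realType} (O : plane R) (x y : R) : plane R := (O.1 + x, O.2 + y).

(** In the cyclic order [a, -c, b, -a, c, -b] with [a + b + c = 0], each side vector is again one of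
    these six vectors, so every side equals the radius. *)
Lemma regular_hexagonP {R : realType} (O : plane R) (a1 a2 b1 b2 c1 c2 r2 : R) :
  a1 + b1 + c1 = 0 -> a2 + b2 + c2 = 0 ->
  a1 ^+ 2 + a2 ^+ 2 = r2 -> b1 ^+ 2 + b2 ^+ 2 = r2 -> c1 ^+ 2 + c2 ^+ 2 = r2 ->
  0 < a1 * b2 - a2 * b1 ->
  regular_hexagon (hexagon (offset O a1 a2) (offset O (- c1) (- c2)) (offset O b1 b2)
    (offset O (- a1) (- a2)) (offset O c1 c2) (offset O (- b1) (- b2))).
Proof.
move=> s1 s2 ra rb rc pos.
have {s1} c1E : c1 = - a1 - b1 by lra.
have {s2} c2E : c2 = - a2 - b2 by lra.
subst c1 c2; set H := hexagon _ _ _ _ _ _.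
have side i : dist (H i) (H (ordS i)) = Num.sqrt r2.
  by case: i => [[|[|[|[|[|[|//]]]]]] ?]; congr Num.sqrt; rewrite /H /hexagon /dot /vec /offset /=; lra.
have side' i : dist (H i) (H (ord_pred i)) = Num.sqrt r2.
  by case: i => [[|[|[|[|[|[|//]]]]]] ?]; congr Num.sqrt; rewrite /H /hexagon /dot /vec /offset /=; lra.
have corner i : dot (vec (H i) (H (ord_pred i))) (vec (H i) (H (ordS i))) = - r2 / 2.
  by case: i => [[|[|[|[|[|[|//]]]]]] ?]; rewrite /H /hexagon /dot /vec /offset /=; lra.
split.
- move=> [[|[|[|[|[|[|//]]]]]] ?] [[|[|[|[|[|[|//]]]]]] ?] // _ _;
    rewrite /H /hexagon /orient /vec /offset /=; lra.
- by move=> i j; rewrite !side.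
- by move=> i j; rewrite /angle !side !side' !corner.
Qed.

(** From [|a + b| = |c|] the scalar product of [a] and [b] is [- r2 / 2], and Lagrange's identity
    then keeps their cross product away from 0. *)
Lemma equilateralP {R : realType} (O : plane R) (a1 a2 b1 b2 c1 c2 r2 : R) :
  0 < r2 -> a1 + b1 + c1 = 0 -> a2 + b2 + c2 = 0 ->
  a1 ^+ 2 + a2 ^+ 2 = r2 -> b1 ^+ 2 + b2 ^+ 2 = r2 -> c1 ^+ 2 + c2 ^+ 2 = r2 ->
  equilateral (offset O a1 a2) (offset O b1 b2) (offset O c1 c2) /\ a1 * b2 - a2 * b1 != 0.
Proof.
move=> r0 s1 s2 ra rb rc.
have {s1} c1E : c1 = - a1 - b1 by lra.
have {s2} c2E : c2 = - a2 - b2 by lra.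
subst c1 c2.
have ab : a1 * b1 + a2 * b2 = - r2 / 2 by lra.
have K0 : a1 * b2 - a2 * b1 != 0.
  apply/eqP => K0.
  have : (a1 ^+ 2 + a2 ^+ 2) * (b1 ^+ 2 + b2 ^+ 2) = (a1 * b1 + a2 * b2) ^+ 2 + (a1 * b2 - a2 * b1) ^+ 2 by ring.
  rewrite ra rb ab K0; have : 0 < r2 ^+ 2 by rewrite exprn_gt0.
  lra.
split=> //; split.
- rewrite /nondegenerate_triangle; suff -> : orient (offset O a1 a2) (offset O b1 b2) (offset O (- a1 - b1) (- a2 - b2)) = 3 * (a1 * b2 - a2 * b1).
    by rewrite mulf_neq0 ?pnatr_eq0.
  by rewrite /orient /vec /offset /=; ring.
- by congr Num.sqrt; rewrite /dot /vec /offset /=; lra.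
- by congr Num.sqrt; rewrite /dot /vec /offset /=; lra.
Qed.

Lemma opposite_equilateral_hexagon {R : realType} (O : plane R) (a1 a2 b1 b2 c1 c2 r2 : R) :
  0 < r2 -> a1 + b1 + c1 = 0 -> a2 + b2 + c2 = 0 ->
  a1 ^+ 2 + a2 ^+ 2 = r2 -> b1 ^+ 2 + b2 ^+ 2 = r2 -> c1 ^+ 2 + c2 ^+ 2 = r2 ->
  regular_hexagon_vertices [set offset O a1 a2; offset O b1 b2; offset O c1 c2;
    offset O (- a1) (- a2); offset O (- b1) (- b2); offset O (- c1) (- c2)].
Proof.
move=> r0 s1 s2 ra rb rc.
have [_] := equilateralP O r0 s1 s2 ra rb rc.
(* A clockwise triangle becomes counterclockwise when [b] and [c] are exchanged. *)
rewrite neq_lt => /orP[K0|K0]; last first.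
  exists (hexagon (offset O a1 a2) (offset O (- c1) (- c2)) (offset O b1 b2)
    (offset O (- a1) (- a2)) (offset O c1 c2) (offset O (- b1) (- b2))).
  split; first exact: (regular_hexagonP O s1 s2 ra rb rc K0).
  by rewrite range_hexagon; apply/seteqP; split=> X /=; tauto.
exists (hexagon (offset O a1 a2) (offset O (- b1) (- b2)) (offset O c1 c2)
    (offset O (- a1) (- a2)) (offset O b1 b2) (offset O (- c1) (- c2))).
split; last by rewrite range_hexagon; apply/seteqP; split=> X /=; tauto.
apply: (regular_hexagonP O _ _ ra rc rb); [by lra|by lra|].
have -> : c1 = - a1 - b1 by lra.
have -> : c2 = - a2 - b2 by lra.
by rewrite -oppr_lt0; apply: le_lt_trans K0; rewrite le_eqVlt; apply/orP; left; apply/eqP; ring.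
Qed.

(** * The circumcircle *)

Lemma circumcenter_exists {R : realType} (A B C : plane R) :
  nondegenerate_triangle A B C ->
  exists (O : plane R) (r2 : R), [/\ 0 < r2, on_circle O r2 A, on_circle O r2 B & on_circle O r2 C].
Proof.
rewrite /nondegenerate_triangle => K0.
pose p := vec A B; pose q := vec A C; pose K := orient A B C.
pose O : plane R := (A.1 + (dot p p * q.2 - dot q q * p.2) / (2 * K),
                     A.2 + (dot q q * p.1 - dot p p * q.1) / (2 * K)).
have OB : on_circle O (dot (vec O A) (vec O A)) B.
  move: K0; rewrite /on_circle /O /K /orient /p /q /dot /vec /= => K0; by field.
have OC : on_circle O (dot (vec O A) (vec O A)) C.
  move: K0; rewrite /on_circle /O /K /orient /p /q /dot /vec /= => K0; by field.
exists O, (dot (vec O A) (vec O A)); split=> //.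
apply: dot_vec_gt0 => OA; case/eqP: K0.
move: OB OC; rewrite /on_circle -OA.
have -> : dot (vec O O) (vec O O) = 0 by rewrite /dot /vec /=; ring.
by move=> /dot_eq0 [h1 h2] /dot_eq0 [h3 h4]; rewrite /orient /vec h1 h2 mul0r mul0r subrr.
Qed.

(** * Convergence *)

(** The telescoping series of the sequence shifted by [N] converges absolutely by comparison with a
    geometric series. *)
Lemma cvgn_geometric_increments {R : realType} (u : nat -> R) (c : R) (N : nat) :
  (forall n, (N <= n)%N -> `|u n.+1 - u n| <= c * 3^-1 ^+ n) -> cvgn u.
Proof.
move=> h; pose v n := u (n + N)%N.
have c0 : 0 <= c.
  have := le_trans (normr_ge0 _) (h N (leqnn _)).
  by rewrite pmulr_lge0 // exprn_gt0 // invr_gt0.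
have hv n : `|v n.+1 - v n| <= geometric c 3^-1 n.
  apply: (le_trans (h (n + N)%N (leq_addl _ _))); rewrite /= ler_wpM2l // exprD.
  by rewrite ler_piMr ?exprn_ge0 ?invr_ge0 // exprn_ile1 ?invr_ge0 // invf_le1 // ler1n.
suff cv : cvgn v.
  apply/cvg_ex; exists (limn v); rewrite -(cvg_shiftn N); exact: cv.
have ct : cvgn (series (telescope v)).
  apply: normed_cvg; apply: (series_le_cvg _ _ hv) => [n|n|]; first exact: normr_ge0.
    by rewrite /= mulr_ge0 ?exprn_ge0 ?invr_ge0.
  by apply: is_cvg_geometric_series; rewrite ger0_norm ?invr_ge0 // invf_lt1 // ltr1n.
have -> : v = (fun n => v 0%N + series (telescope v) n).
  by apply/funext => n; rewrite -eq_sum_telescope.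
apply/cvg_ex; exists (v 0%N + limn (series (telescope v))).
by apply: cvgD; [exact: cvg_cst|exact: ct].
Qed.

Lemma cvg_even {T : topologicalType} (u : nat -> T) (l : T) :
  u n @[n --> \oo] --> l -> u (2 * n)%N @[n --> \oo] --> l.
Proof. by move=> h; apply: cvg_comp h; exact: cvg_mulnl. Qed.

Lemma cvg_odd {T : topologicalType} (u : nat -> T) (l : T) :
  u n @[n --> \oo] --> l -> u (2 * n).+1 @[n --> \oo] --> l.
Proof.
move=> h; apply: (@cvg_even _ (fun n => u n.+1)).
apply: cvg_comp h; exact: (cvg_addnl 1).
Qed.

Lemma cvg_alternating {R : realType} (x : nat -> R) (o l : R) :
  (-1) ^+ n * (x n - o) @[n --> \oo] --> l ->
  x (2 * n)%N @[n --> \oo] --> o + l /\ x (2 * n).+1 @[n --> \oo] --> o - l.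
Proof.
move=> h; split.
- have -> : (fun n => x (2 * n)%N) = (fun n => o + (-1) ^+ (2 * n) * (x (2 * n)%N - o)).
    by apply/funext => n; rewrite exprM sqrrN expr1n expr1n mul1r; ring.
  by apply: cvgD; [exact: cvg_cst|exact: (cvg_even h)].
- have -> : (fun n => x (2 * n).+1) = (fun n => o - (-1) ^+ (2 * n).+1 * (x (2 * n).+1 - o)).
    by apply/funext => n; rewrite exprS exprM sqrrN expr1n expr1n mulr1; ring.
  by apply: cvgB; [exact: cvg_cst|exact: (cvg_odd h)].
Qed.

Lemma cvg_third {R : realType} (s : nat -> R) : (forall n, 3 * s n.+1 = s n) ->
  (-1) ^+ n * s n @[n --> \oo] --> 0.
Proof.
move=> h.
have -> : (fun n => (-1) ^+ n * s n) = geometric (s 0%N) (- 3^-1).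
  apply/funext; elim=> [|n IH]; first by rewrite /= !expr0; ring.
  rewrite /= in IH *; rewrite [in RHS]exprS mulrCA -IH -(h n) exprS; by field.
by apply: cvg_geometric; rewrite normrN ger0_norm ?invr_ge0 // invf_lt1 // ltr1n.
Qed.

Lemma norm_le_of_sqr {R : realType} (x y c : R) : 0 <= c -> x ^+ 2 + y ^+ 2 <= c ^+ 2 ->
  `|x| <= c /\ `|y| <= c.
Proof.
move=> c0 h; have x2 := sqr_ge0 x; have y2 := sqr_ge0 y.
by split; rewrite -(@ler_pXn2r _ 2) // ?nnegrE // real_normK ?num_real //; lra.
Qed.

(* The reflection [X |-> 2 O - X] turns the sequence into one with geometrically
   decreasing increments. *)
Lemma cvg_vertex {R : realType} (A : nat -> plane R) (O : plane R) (c : R) (N : nat) :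
  0 <= c ->
  (forall n, (N <= n)%N -> sqnorm (cplx O (A n.+1) + cplx O (A n)) <= (c * 3^-1 ^+ n) ^+ 2) ->
  exists l1 l2, [/\ (-1) ^+ n * ((A n).1 - O.1) @[n --> \oo] --> l1,
    (-1) ^+ n * ((A n).2 - O.2) @[n --> \oo] --> l2,
    A (2 * n)%N @[n --> \oo] --> offset O l1 l2 &
    A (2 * n).+1 @[n --> \oo] --> offset O (- l1) (- l2)].
Proof.
move=> c0 h.
have sgn n (x y : R) : `|(-1) ^+ n.+1 * x - (-1) ^+ n * y| = `|x + y|.
  rewrite exprS mulN1r mulNr -opprD -mulrDr normrN normrM normrX normrN1 expr1n mul1r //.
have bnd n : (N <= n)%N ->
   `|(A n.+1).1 - O.1 + ((A n).1 - O.1)| <= c * 3^-1 ^+ n /\ `|(A n.+1).2 - O.2 + ((A n).2 - O.2)| <= c * 3^-1 ^+ n.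
  move=> /h; apply: norm_le_of_sqr; by rewrite mulr_ge0 // exprn_ge0 // invr_ge0.
have c1 : cvgn (fun n => (-1) ^+ n * ((A n).1 - O.1)).
  apply: (@cvgn_geometric_increments _ _ c N) => n Nn; rewrite sgn; exact: (bnd n Nn).1.
have c2 : cvgn (fun n => (-1) ^+ n * ((A n).2 - O.2)).
  apply: (@cvgn_geometric_increments _ _ c N) => n Nn; rewrite sgn; exact: (bnd n Nn).2.
exists (limn (fun n => (-1) ^+ n * ((A n).1 - O.1))), (limn (fun n => (-1) ^+ n * ((A n).2 - O.2))).
have [e1 o1] := @cvg_alternating _ (fun n => (A n).1) O.1 _ c1.
have [e2 o2] := @cvg_alternating _ (fun n => (A n).2) O.2 _ c2.
have pairE (f : nat -> plane R) : (fun n => f n) = (fun n => ((f n).1, (f n).2)).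
  by apply/funext => n; case: (f n).
split=> //; rewrite [X in X @ _]pairE /offset.
- exact: cvg_pair e1 e2.
- exact: cvg_pair o1 o2.
Qed.

Lemma alternating_limit_norm {R : realType} (x y : nat -> R) (l1 l2 r2 : R) :
  (forall n, x n ^+ 2 + y n ^+ 2 = r2) ->
  (-1) ^+ n * x n @[n --> \oo] --> l1 -> (-1) ^+ n * y n @[n --> \oo] --> l2 ->
  l1 ^+ 2 + l2 ^+ 2 = r2.
Proof.
move=> h h1 h2.
have e : (fun=> r2) = (fun n => (-1) ^+ n * x n * ((-1) ^+ n * x n) + (-1) ^+ n * y n * ((-1) ^+ n * y n)).
  apply/funext => n; rewrite -(h n).
  have s1 : ((-1) ^+ n) ^+ 2 = 1 :> R by rewrite exprAC sqrrN !expr1n.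
  transitivity (((-1) ^+ n) ^+ 2 * (x n ^+ 2 + y n ^+ 2)); first by rewrite s1 mul1r.
  by ring.
have c : (fun=> r2) n @[n --> \oo] --> l1 ^+ 2 + l2 ^+ 2.
  by rewrite e; apply: cvgD; exact: cvgM.
have c' : (fun=> r2) n @[n --> \oo] --> r2 by exact: cvg_cst.
exact: (cvg_unique _ c c').
Qed.

Lemma alternating_limit_sum {R : realType} (x y z : nat -> R) (l1 l2 l3 : R) :
  (forall n, 3 * (x n.+1 + y n.+1 + z n.+1) = x n + y n + z n) ->
  (-1) ^+ n * x n @[n --> \oo] --> l1 -> (-1) ^+ n * y n @[n --> \oo] --> l2 ->
  (-1) ^+ n * z n @[n --> \oo] --> l3 -> l1 + l2 + l3 = 0.
Proof.
move=> h h1 h2 h3.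
have e : (fun n => (-1) ^+ n * (x n + y n + z n)) =
    (fun n => (-1) ^+ n * x n + (-1) ^+ n * y n + (-1) ^+ n * z n).
  by apply/funext => n; ring.
have h0 := cvg_third h; rewrite e in h0.
have h' : (-1) ^+ n * x n + (-1) ^+ n * y n + (-1) ^+ n * z n @[n --> \oo] --> l1 + l2 + l3.
  by apply: cvgD => //; exact: cvgD.
exact: (cvg_unique _ h' h0).
Qed.

(** * The iteration on a fixed circumcircle and its two limits *)

Theorem corollary3 (R : realType) (A B C : nat -> plane R)
  (hABC : nondegenerate_triangle (A 0%N) (B 0%N) (C 0%N))
  (hstep : forall i : nat,
    (A i.+1, B i.+1, C i.+1) =
    focal_triangle (centroid (A i) (B i) (C i)) (A i) (B i) (C i)) :
  exists Ae Be Ce Ao Bo Co : plane R,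
    [/\ [/\ A (2 * i)%N @[i --> \oo] --> Ae,
            B (2 * i)%N @[i --> \oo] --> Be &
            C (2 * i)%N @[i --> \oo] --> Ce],
        [/\ A (2 * i).+1%N @[i --> \oo] --> Ao,
            B (2 * i).+1%N @[i --> \oo] --> Bo &
            C (2 * i).+1%N @[i --> \oo] --> Co],
        equilateral Ae Be Ce /\ equilateral Ao Bo Co &
        regular_hexagon_vertices [set Ae; Be; Ce; Ao; Bo; Co]].
Proof.
have [ O [r2 [r0 OA0 OB0 OC0]]] := circumcenter_exists hABC.
have centroid_rot X Y Z : centroid Y Z X = centroid X Y Z :> plane R.
  by rewrite /centroid; congr pair; congr (_ / _); ring.
have spec i : nondegenerate_triangle (A i) (B i) (C i) ->
    on_circle O r2 (A i) -> on_circle O r2 (B i) -> on_circle O r2 (C i) ->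
    [/\ opposite_focus_spec O r2 (A i) (B i) (C i) (A i.+1),
        opposite_focus_spec O r2 (B i) (C i) (A i) (B i.+1) &
        opposite_focus_spec O r2 (C i) (A i) (B i) (C i.+1)].
  move=> K0 OA OB OC; have [-> -> ->] := hstep i; split.
  - exact: opposite_focusP.
  - rewrite -(centroid_rot (A i)); apply: opposite_focusP => //.
    by rewrite /nondegenerate_triangle orient_rot.
  - rewrite -(centroid_rot (A i)) -(centroid_rot (B i)); apply: opposite_focusP => //.
    by rewrite /nondegenerate_triangle -(orient_rot (C i)).
(* All triangles share the circumcircle of the initial one. *)
have inv i : [/\ nondegenerate_triangle (A i) (B i) (C i),
    on_circle O r2 (A i), on_circle O r2 (B i) & on_circle O r2 (C i)].
  elim: i => [//|i [K0 OA OB OC]].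
  have [sA sB sC] := spec i K0 OA OB OC.
  have [K1 _] := focal_triangle_step K0 OA OB OC sA sB sC.
  by case: sA sB sC => [? _ _] [? _ _] [? _ _].
have {}spec i : [/\ opposite_focus_spec O r2 (A i) (B i) (C i) (A i.+1),
        opposite_focus_spec O r2 (B i) (C i) (A i) (B i.+1) &
        opposite_focus_spec O r2 (C i) (A i) (B i) (C i.+1)].
  by have [K0 OA OB OC] := inv i; exact: spec.
pose S i := cplx O (A i) + cplx O (B i) + cplx O (C i).
have SE i : 3 * S i.+1 = S i.
  have [K0 OA OB OC] := inv i; have [sA sB sC] := spec i.
  by have [_] := focal_triangle_step K0 OA OB OC sA sB sC.
have S1 i : 3 * ((A i.+1).1 - O.1 + ((B i.+1).1 - O.1) + ((C i.+1).1 - O.1)) =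
    (A i).1 - O.1 + ((B i).1 - O.1) + ((C i).1 - O.1).
  have /(congr1 (@complex.Re R)) /= <- := SE i; ring.
have S2 i : 3 * ((A i.+1).2 - O.2 + ((B i.+1).2 - O.2) + ((C i.+1).2 - O.2)) =
    (A i).2 - O.2 + ((B i).2 - O.2) + ((C i).2 - O.2).
  have /(congr1 (@complex.Im R)) /= <- := SE i; ring.
have Sn i : sqnorm (S i) = sqnorm (S 0%N) * (3^-1 ^+ i) ^+ 2.
  elim: i => [|i IH]; first by rewrite expr0 expr1n mulr1.
  have IH' : 9 * sqnorm (S i.+1) = sqnorm (S i).
    by rewrite -(SE i) sqnormM; congr (_ * _); rewrite /sqnorm /=; ring.
  have -> : sqnorm (S i.+1) = sqnorm (S i) / 9 by rewrite -IH'; field.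
  by rewrite IH [3^-1 ^+ i.+1]exprS; field.
(* The vertex sum shrinks by the factor 3 in each step, so the triangles eventually are nearly
   equilateral in the sense of the contraction bound. *)
have [N small] : exists N, forall n, (N <= n)%N -> 20 * sqnorm (S n) <= r2.
  have cv : 20 * sqnorm (S 0%N) * (3^-1 ^+ 2) ^+ n @[n --> \oo] --> 0.
    apply: (@cvg_geometric _ (20 * sqnorm (S 0%N)) (3^-1 ^+ 2)).
    by rewrite normrX ger0_norm ?invr_ge0 // exprn_ilt1 // ?invr_ge0 // invf_lt1 // ltr1n.
  have [N _ hN] := cvgr_le _ cv _ r0.
  by exists N => n /hN h; rewrite Sn mulrA exprAC.
(* Chosen so that the contraction bound at step [n] is exactly [(c * 3^-1 ^+ n) ^+ 2]. *)
pose c := Num.sqrt (114 * sqnorm (S 0%N)).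
have c0 : 0 <= c by exact: sqrtr_ge0.
have cE n : 114 * sqnorm (S n) = (c * 3^-1 ^+ n) ^+ 2.
  by rewrite exprMn sqr_sqrtr ?mulr_ge0 ?sqnorm_ge0 // Sn mulrA.
have [bA bB bC] : [/\ forall n, (N <= n)%N -> sqnorm (cplx O (A n.+1) + cplx O (A n)) <= (c * 3^-1 ^+ n) ^+ 2,
    forall n, (N <= n)%N -> sqnorm (cplx O (B n.+1) + cplx O (B n)) <= (c * 3^-1 ^+ n) ^+ 2 &
    forall n, (N <= n)%N -> sqnorm (cplx O (C n.+1) + cplx O (C n)) <= (c * 3^-1 ^+ n) ^+ 2].
  have SB n : cplx O (B n) + cplx O (C n) + cplx O (A n) = S n by rewrite /S; ring.
  have SC n : cplx O (C n) + cplx O (A n) + cplx O (B n) = S n by rewrite /S; ring.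
  split=> n /small Sr; rewrite -cE; have [_ OA OB OC] := inv n; have [sA sB sC] := spec n.
  - exact: (focal_triangle_contraction OA OB OC sA Sr).
  - by have := focal_triangle_contraction OB OC OA sB; rewrite SB; exact.
  - by have := focal_triangle_contraction OC OA OB sC; rewrite SC; exact.
have [a1 [a2 [la1 la2 ea oa]]] := cvg_vertex c0 bA.
have [b1 [b2 [lb1 lb2 eb ob]]] := cvg_vertex c0 bB.
have [c1 [c2 [lc1 lc2 ec oc]]] := cvg_vertex c0 bC.
have s1 := alternating_limit_sum S1 la1 lb1 lc1.
have s2 := alternating_limit_sum S2 la2 lb2 lc2.
have [rA rB rC] : [/\ forall n, sqnorm (cplx O (A n)) = r2,
    forall n, sqnorm (cplx O (B n)) = r2 & forall n, sqnorm (cplx O (C n)) = r2].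
  by split=> n; apply/on_circle_sqnorm; case: (inv n).
have ra := alternating_limit_norm rA la1 la2.
have rb := alternating_limit_norm rB lb1 lb2.
have rc := alternating_limit_norm rC lc1 lc2.
(* The odd limits are the even ones reflected in [O]. *)
exists (offset O a1 a2), (offset O b1 b2), (offset O c1 c2),
  (offset O (- a1) (- a2)), (offset O (- b1) (- b2)), (offset O (- c1) (- c2)).
split=> //; last exact: (opposite_equilateral_hexagon O r0 s1 s2 ra rb rc).
split; first exact: (equilateralP O r0 s1 s2 ra rb rc).1.
apply: (equilateralP O r0 _ _ _ _ _).1; rewrite ?sqrrN //.
- by rewrite -!opprD s1 oppr0.
- by rewrite -!opprD s2 oppr0.
Qed.
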